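(* Let $K$ be a field, $Q$ a quiver, $a$ a sink of $Q$, $\boldsymbol{\underline d}=(\underline d^0,\dots,\underline d^\nu)$ a filtration and $M\in\mathrm{Rep}_Q(\underline d^\nu)\langle a\rangle$. The map $$S_a^+\colon\mathrm{Fl}_Q\binom{M}{\boldsymbol{\underline d}}\langle a\rangle\to\mathrm{Fl}_{\sigma_aQ}\binom{S_a^+M}{\sigma_a\boldsymbol{\underline d}}\langle a\rangle,\qquad \boldsymbol U\mapsto S_a^+\boldsymbol U,$$ is an isomorphism of varieties with inverse $\hat D\circ S_a^+\circ\hat D=S_a^-$.
   Context: $Q$ is a finite quiver. A filtration is a sequence of dimension vectors with $\underline d^0=0$, $\underline d^i\le\underline d^{i+1}$. $\mathrm{Fl}_Q\binom{M}{\boldsymbol{\underline d}}$ is the projective variety of flags $\boldsymbol U=(U^0\subset\dots\subset U^\nu=M)$ of subrepresentations with $\underline\dim U^i=\underline d^i$. $\mathrm{Rep}_Q(\underline d)$ is the space of $K$-representations of dimension vector $\underline d$. Reflections: $\sigma_aQ$ is obtained from $Q$ by reversing all arrows at $a$. With $(\underline d,\underline e)=\langle\underline d,\underline e\rangle+\langle\underline e,\underline d\rangle$, $\langle\underline d,\underline e\rangle=\sum_id_ie_i-\sum_{\alpha:i\to j}d_ie_j$, put $\sigma_a\underline d=\underline d-(\underline d,\epsilon_a)\epsilon_a$ ($\epsilon_a$ the unit vector at $a$) and $\sigma_a\boldsymbol{\underline d}=(\sigma_a\underline d^0,\dots,\sigma_a\underline d^\nu)$. For a sink $a$ and representation $X$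 let $\phi_a^X=(X_\alpha)\colon\bigoplus_{\alpha:j\to a}X_j\to X_a$. $S_a^+X$ is the representation of $\sigma_aQ$ with $(S_a^+X)_i=X_i$ for $i\ne a$, $(S_a^+X)_a=\ker\phi_a^X$ and, for each reversed arrow, the map $\ker\phi_a^X\hookrightarrow\bigoplus X_j\to X_i$. If $\boldsymbol U$ is a flag of $M$, then $S_a^+\boldsymbol U=(S_a^+U^0\subset\dots\subset S_a^+U^\nu=S_a^+M)$. The reflection functor $S_b^-$ at a source $b$ is defined dually; for $M$ with $\mathrm{Hom}(M,S_a)=0$ the representation $S_a^-S_a^+M$ is identified with $M$. Open conditions: for a sink $a$, with $S_a$ the simple at $a$, $\mathrm{Rep}_Q(\underline d)\langle a\rangle=\{M:\mathrm{Hom}(M,S_a)=0\}$ and $\mathrm{Fl}_Q\binom{M}{\boldsymbol{\underline d}}\langle a\rangle=\{\boldsymbol U:\mathrm{Hom}(U^i,S_a)=0\text{ for all }i\}$. For a source $b$, $\mathrm{Fl}_Q\binom{M}{\boldsymbol{\underline d}}\langle b\rangle=\{\boldsymbol U:\mathrm{Hom}(S_b,M/U^i)=0\text{ for all }i\}$ (in the target above, $a$ is a source of $\sigma_aQ$). Duality: with $D=\mathrm{Hom}_K(-,K)$ and $\underline e^{\nu-i}=\underline d^\nu-\underline d^i$, $\hat D\colon\mathrm{Fl}_Q\binom{M}{\boldsymbol{\underline d}}\to\mathrm{Fl}_{Q^{op}}\binom{DM}{\boldsymbol{\underline e}}$ sends $\boldsymbol U$ to the flag whose members are the subrepresentations $\ker(DM\to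 D(U^i))=D(M/U^i)$ of $DM$, arranged in increasing order. Flags at the source $a$ of $\sigma_a Q$ are thus reflected by $S_a^-:=\hat D\circ S_a^+\circ\hat D$. *)

(* Defs.v *)
From HB Require Import structures.
From mathcomp Require Import all_boot all_order all_algebra.
From mathcomp Require Import boolp classical_sets.

Set Implicit Arguments.
Unset Strict Implicit.
Unset Printing Implicit Defensive.

Import Order.TTheory GRing.Theory Num.Theory.
Local Open Scope classical_set_scope.
Local Open Scope ring_scope.

Record quiver (Q0 Q1 : finType) := Quiver { src : Q1 -> Q0; tgt : Q1 -> Q0 }.

Definition op (Q0 Q1 : finType) (Q : quiver Q0 Q1) : quiver Q0 Q1 :=
  Quiver (tgt Q) (src Q).

Definition at_vertex (Q0 Q1 : finType) (Q : quiver Q0 Q1) (a : Q0) (al : Q1) :=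
  (src Q al == a) || (tgt Q al == a).

Definition reflect_quiver (Q0 Q1 : finType) (a : Q0) (Q : quiver Q0 Q1) :
    quiver Q0 Q1 :=
  Quiver (fun al => if at_vertex Q a al then tgt Q al else src Q al)
         (fun al => if at_vertex Q a al then src Q al else tgt Q al).

Definition is_sink (Q0 Q1 : finType) (Q : quiver Q0 Q1) (a : Q0) :=
  forall al, src Q al != a.

(** The reflection of a dimension vector may have a negative entry, so
   reflections are taken in the integers. *)

Definition euler_form (Q0 Q1 : finType) (Q : quiver Q0 Q1) (d e : Q0 -> int) :
    int :=
  \sum_i d i * e i - \sum_al d (src Q al) * e (tgt Q al).

Definition sym_form (Q0 Q1 : finType) (Q : quiver Q0 Q1) (d e : Q0 -> int) :
    int :=
  euler_form Q d e + euler_form Q e d.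

Definition unit_dim (Q0 : finType) (a : Q0) (i : Q0) : int := (i == a)%:Z.

Definition reflect_dim (Q0 Q1 : finType) (Q : quiver Q0 Q1) (a : Q0)
    (d : Q0 -> int) (i : Q0) : int :=
  d i - sym_form Q d (unit_dim a) * unit_dim a i.

Definition is_filtration (Q0 : finType) (nu : nat)
    (d : 'I_nu.+1 -> Q0 -> nat) :=
  (forall i, d ord0 i = 0%N) /\
  (forall (k l : 'I_nu.+1) i, (k <= l)%N -> (d k i <= d l i)%N).

(** Vectors are rows, and an arrow acts by right multiplication. *)

Definition rep (R : nzRingType) (Q0 Q1 : finType) (Q : quiver Q0 Q1)
    (n : Q0 -> nat) :=
  forall al : Q1, 'M[R]_(n (src Q al), n (tgt Q al)).

Definition map_rep (R S : nzRingType) (f : R -> S) (Q0 Q1 : finType)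
    (Q : quiver Q0 Q1) (n : Q0 -> nat) (X : rep R Q n) : rep S Q n :=
  fun al => map_mx f (X al).

Definition dual_rep (R : nzRingType) (Q0 Q1 : finType) (Q : quiver Q0 Q1)
    (n : Q0 -> nat) (X : rep R Q n) : rep R (op Q) n :=
  fun al => (X al)^T.

Definition simple_rep (R : nzRingType) (Q0 Q1 : finType) (Q : quiver Q0 Q1)
    (a : Q0) : rep R Q (fun i => nat_of_bool (i == a)) :=
  fun al => 0.

Definition subfamily (R : nzRingType) (Q0 : finType) (n : Q0 -> nat) :=
  forall i : Q0, set 'rV[R]_(n i).

(** [Hom (W, Z) = 0] for a subrepresentation [W] of [X]; only the values of
   [F i] on [W i] matter. *)
Definition hom_sub_zero (R : nzRingType) (Q0 Q1 : finType)
    (Q : quiver Q0 Q1) (n m : Q0 -> nat) (X : rep R Q n)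
    (W : subfamily R n) (Z : rep R Q m) :=
  forall F : (forall i, 'rV[R]_(n i) -> 'rV[R]_(m i)),
    (forall i c u v, W i u -> W i v ->
       F i (c *: u + v) = c *: F i u + F i v) ->
    (forall al u, W (src Q al) u ->
       F (tgt Q al) (u *m X al) = F (src Q al) u *m Z al) ->
  forall i u, W i u -> F i u = 0.

(** [Hom (Z, X / W) = 0] for a subrepresentation [W] of [X]; a map to the
   quotient is given by representatives in [X]. *)
Definition hom_quot_zero (R : nzRingType) (Q0 Q1 : finType)
    (Q : quiver Q0 Q1) (n m : Q0 -> nat) (Z : rep R Q m)
    (X : rep R Q n) (W : subfamily R n) :=
  forall G : (forall i, 'rV[R]_(m i) -> 'rV[R]_(n i)),
    (forall i c u v, W i (G i (c *: u + v) - (c *: G i u + G i v))) ->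
    (forall al u,
       W (tgt Q al) (G (tgt Q al) (u *m Z al) - G (src Q al) u *m X al)) ->
  forall i u, W i (G i u).

(** Coordinates of the direct sum, over the arrows [al] ending at [a], of the
   spaces at [src Q al]. *)
Definition in_coord (Q0 Q1 : finType) (Q : quiver Q0 Q1) (n : Q0 -> nat)
    (a : Q0) : finType :=
  {x : {al : Q1 & 'I_(n (src Q al))} | tgt Q (tag x) == a}.

(** The projection of that direct sum to the summand of [al]. *)
Definition in_proj (R : nzRingType) (Q0 Q1 : finType) (Q : quiver Q0 Q1)
    (n : Q0 -> nat) (a : Q0) (al : Q1) :
    'M[R]_(#|in_coord Q n a|, n (src Q al)) :=
  \matrix_(k, x)
    (val (enum_val k) == Tagged (fun be => 'I_(n (src Q be))) x)%:R.

Definition phi (R : nzRingType) (Q0 Q1 : finType) (Q : quiver Q0 Q1)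
    (n : Q0 -> nat) (a : Q0) (X : rep R Q n) :
    'M[R]_(#|in_coord Q n a|, n a) :=
  \sum_(be : {al : Q1 | tgt Q al == a})
     in_proj R Q n a (val be) *m
     castmx (erefl, congr1 n (eqP (valP be))) (X (val be)).

Definition ker_dim (K : fieldType) (Q0 Q1 : finType) (Q : quiver Q0 Q1)
    (n : Q0 -> nat) (a : Q0) (X : rep K Q n) : nat :=
  \rank (kermx (phi a X)).

(** The inclusion of [ker (phi a X)], in coordinates given by a basis. *)
Definition ker_incl (K : fieldType) (Q0 Q1 : finType) (Q : quiver Q0 Q1)
    (n : Q0 -> nat) (a : Q0) (X : rep K Q n) :
    'M[K]_(ker_dim a X, #|in_coord Q n a|) :=
  row_base (kermx (phi a X)).

Definition sink_dim (K : fieldType) (Q0 Q1 : finType) (Q : quiver Q0 Q1)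
    (n : Q0 -> nat) (a : Q0) (X : rep K Q n) (i : Q0) : nat :=
  if i == a then ker_dim a X else n i.

(** If [a] is a sink, an arrow touching [a] ends there and does not start
   there, so the branches with value [0] are never reached. *)
Definition sink_reflection (K : fieldType) (Q0 Q1 : finType)
    (Q : quiver Q0 Q1) (n : Q0 -> nat) (a : Q0) (X : rep K Q n) :
    rep K (reflect_quiver a Q) (sink_dim a X) :=
  fun al =>
    match at_vertex Q a al as b return
      'M[K]_(sink_dim a X (if b then tgt Q al else src Q al),
             sink_dim a X (if b then src Q al else tgt Q al))
    with
    | true =>
        match tgt Q al == a as b1, src Q al == a as b2 return
          'M[K]_(if b1 then ker_dim a X else n (tgt Q al),
                 if b2 then ker_dim a X else n (src Q al))
        with
        | true, false => ker_incl a X *m in_proj K Q n a al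
        | _, _ => 0
        end
    | false =>
        match src Q al == a as b1, tgt Q al == a as b2 return
          'M[K]_(if b1 then ker_dim a X else n (src Q al),
                 if b2 then ker_dim a X else n (tgt Q al))
        with
        | false, false => X al
        | _, _ => 0
        end
    end.

Definition source_dim (K : fieldType) (Q0 Q1 : finType) (Q : quiver Q0 Q1)
    (n : Q0 -> nat) (a : Q0) (Y : rep K Q n) : Q0 -> nat :=
  sink_dim a (dual_rep Y).

Definition source_reflection (K : fieldType) (Q0 Q1 : finType)
    (Q : quiver Q0 Q1) (n : Q0 -> nat) (a : Q0) (Y : rep K Q n) :
    rep K (op (reflect_quiver a (op Q))) (source_dim a Y) :=
  dual_rep (sink_reflection a (dual_rep Y)).

(** An isomorphism between a representation [Y] of [P] and a representation
   [X] of [Q] that is the identity away from [a]. It is used for quivers whose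
   sources and targets agree, but not by conversion; vectors are therefore
   compared as elements of the disjoint union of the vertex spaces. For
   [Y = S_a^- S_a^+ X] with [a] a sink and [Hom (X, S_a) = 0], there is exactly
   one such [theta]: [Y_a] is the sum of the images of the arrows ending at
   [a]. *)
Definition is_identification (K : fieldType) (Q0 Q1 : finType) (a : Q0)
    (P Q : quiver Q0 Q1) (n m : Q0 -> nat) (Y : rep K P n) (X : rep K Q m)
    (theta : forall i, 'M[K]_(n i, m i)) :=
  [/\ (forall al, src P al = src Q al /\ tgt P al = tgt Q al),
      (forall al (v : 'rV[K]_(n (src P al))) (w : 'rV[K]_(m (src Q al))),
         Tagged (fun i => 'rV[K]_(m i)) (v *m theta (src P al)) =
         Tagged (fun i => 'rV[K]_(m i)) w ->
         Tagged (fun i => 'rV[K]_(m i)) (v *m Y al *m theta (tgt P al)) =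
         Tagged (fun i => 'rV[K]_(m i)) (w *m X al)),
      (forall i, exists eta : 'M[K]_(m i, n i),
         theta i *m eta = 1%:M /\ eta *m theta i = 1%:M) &
      (forall i, i != a -> n i = m i /\
         forall x y, theta i x y = (x == y :> nat)%:R)].

Definition flag (nu : nat) (R : nzRingType) (Q0 : finType)
    (n : Q0 -> nat) :=
  'I_nu.+1 -> subfamily R n.

(** [U] is a direct summand of [R^n] (the image of an idempotent) whose fibre
   at every field-valued point of [R] has dimension [r]: an [R]-valued point of
   the Grassmannian of [r]-dimensional subspaces. *)
Definition summand_of_rank (R : comNzRingType) (n : nat)
    (U : set 'rV[R]_n) (r : int) :=
  exists P : 'M[R]_n,
    [/\ P *m P = P,
        U = [set v | exists w, v = w *m P] &
        forall (L : fieldType) (f : {rmorphism R -> L}),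
          (\rank (map_mx f P))%:Z = r].

Definition is_subrep (R : nzRingType) (Q0 Q1 : finType) (Q : quiver Q0 Q1)
    (n : Q0 -> nat) (X : rep R Q n) (W : subfamily R n) :=
  forall al u, W (src Q al) u -> W (tgt Q al) (u *m X al).

Definition is_flag (R : comNzRingType) (Q0 Q1 : finType) (Q : quiver Q0 Q1)
    (n : Q0 -> nat) (X : rep R Q n) (nu : nat)
    (e : 'I_nu.+1 -> Q0 -> int) (U : flag nu R n) :=
  [/\ (forall k i, summand_of_rank (U k i) (e k i)),
      (forall k, is_subrep X (U k)),
      (forall (k l : 'I_nu.+1) i, (k <= l)%N -> U k i `<=` U l i) &
      (forall i, U ord_max i = setT)].

(** Base change: the submodule generated by the image. *)
Definition map_flag (R S : nzRingType) (f : R -> S) (nu : nat)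
    (Q0 : finType) (n : Q0 -> nat) (U : flag nu R n) : flag nu S n :=
  fun k i => [set v | exists (m : nat) (c : 'I_m -> S)
                             (u : 'I_m -> 'rV[R]_(n i)),
                (forall l, U k i (u l)) /\
                v = \sum_l c l *: map_mx f (u l)].

Definition transport_flag (R : nzRingType) (nu : nat) (Q0 : finType)
    (n m : Q0 -> nat) (theta : forall i, 'M[R]_(n i, m i))
    (U : flag nu R n) : flag nu R m :=
  fun k i => [set u *m theta i | u in U k i].

(** Varieties are given by their functors of points: the [R]-valued points, for
   each commutative [K]-algebra [R], form a subset [pts R] of [ambient R]. By
   the Yoneda lemma the morphisms of varieties over [K] are the natural
   transformations; for a finite field the [K]-points alone would not do. *)

Record points_functor (K : fieldType) := PointsFunctor {
  ambient : comAlgType K -> Type;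
  pts : forall R : comAlgType K, set (ambient R);
  base_change : forall R S : comAlgType K,
    {lrmorphism R -> S} -> ambient R -> ambient S }.

Arguments ambient {K} p R.
Arguments pts {K} p R _.
Arguments base_change {K} p {R S} h _.

Definition is_morphism (K : fieldType) (X Y : points_functor K)
    (f : forall R, ambient X R -> ambient Y R) :=
  (forall R u, pts X R u -> pts Y R (f R u)) /\
  (forall (R S : comAlgType K) (h : {lrmorphism R -> S}) u, pts X R u ->
     f S (base_change X h u) = base_change Y h (f R u)).

Definition is_isomorphism_with_inverse (K : fieldType)
    (X Y : points_functor K) (f : forall R, ambient X R -> ambient Y R)
    (g : forall R, ambient Y R -> ambient X R) :=
  [/\ is_morphism f, is_morphism g,
      (forall R u, pts X R u -> g R (f R u) = u) &
      (forall R v, pts Y R v -> f R (g R v) = v)].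

(** The open loci: a flag over [R] belongs to an open subvariety exactly when
   its fibres at all field-valued points of [R] do. *)
Definition Fl_sink (K : fieldType) (Q0 Q1 : finType) (Q : quiver Q0 Q1)
    (n : Q0 -> nat) (X : rep K Q n) (nu : nat)
    (e : 'I_nu.+1 -> Q0 -> int) (a : Q0) : points_functor K :=
  @PointsFunctor K (fun R => flag nu R n)
    (fun R => [set U | is_flag (map_rep (in_alg R) X) e U /\
       forall (L : fieldType) (f : {rmorphism R -> L}) k,
         hom_sub_zero (map_rep f (map_rep (in_alg R) X))
           (map_flag f U k) (simple_rep L Q a)])
    (fun R S h U => map_flag h U).

Definition Fl_source (K : fieldType) (Q0 Q1 : finType) (Q : quiver Q0 Q1)
    (n : Q0 -> nat) (X : rep K Q n) (nu : nat)
    (e : 'I_nu.+1 -> Q0 -> int) (b : Q0) : points_functor K :=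
  @PointsFunctor K (fun R => flag nu R n)
    (fun R => [set U | is_flag (map_rep (in_alg R) X) e U /\
       forall (L : fieldType) (f : {rmorphism R -> L}) k,
         hom_quot_zero (simple_rep L Q b)
           (map_rep f (map_rep (in_alg R) X)) (map_flag f U k)])
    (fun R S h U => map_flag h U).

(** At [a]: the elements of [ker (phi a X)] with all components in [U]. *)
Definition sink_flag (K : fieldType) (Q0 Q1 : finType) (Q : quiver Q0 Q1)
    (n : Q0 -> nat) (a : Q0) (X : rep K Q n) (nu : nat) (R : comAlgType K)
    (U : flag nu R n) : flag nu R (sink_dim a X) :=
  fun k i =>
    match i == a as b return
      set 'rV[R]_(if b then ker_dim a X else n i)
    with
    | true => [set w | forall al, tgt Q al = a ->
                 U k (src Q al) (w *m map_mx (in_alg R) (ker_incl a X)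
                                   *m in_proj R Q n a al)]
    | false => U k i
    end.

Definition dual_flag (R : nzRingType) (nu : nat) (Q0 : finType)
    (n : Q0 -> nat) (U : flag nu R n) : flag nu R n :=
  fun k i => [set x | forall u, U (rev_ord k) i u -> u *m x^T = 0].

Definition source_flag (K : fieldType) (Q0 Q1 : finType) (Q : quiver Q0 Q1)
    (n : Q0 -> nat) (a : Q0) (Y : rep K Q n) (nu : nat) (R : comAlgType K)
    (V : flag nu R n) : flag nu R (source_dim a Y) :=
  dual_flag (sink_flag (X := dual_rep Y) (a := a) (dual_flag V)).

(* Main.v *)
Require Import Defs.
From HB Require Import structures.
From mathcomp Require Import all_boot all_order all_algebra.
From mathcomp Require Import boolp classical_sets.
Import GRing.Theory.
Local Open Scope classical_set_scope.
Local Open Scope ring_scope.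

(** Over a field, [0 -> (S_a^+ M)_a -> E -> M_a -> 0] is split exact, where [E]
   is the sum of the spaces at the sources of the arrows ending at [a]; it stays
   so over every [K]-algebra. A flag [U] with surjective [E_U -> U_a] and a flag
   [V] on the reflected side with [V_a] equal to the preimage of [E_V] determine
   each other: they agree away from [a], [V_a] is the kernel of [E_U -> U_a] and
   [U_a] is the image of [E_V]. The open conditions state this on fibres at
   fields; by Nakayama's lemma (through residue fields of maximal ideals) the
   fibrewise surjections, resp. injections, of projective modules are split, so
   the kernel, resp. the image, is again a direct summand. On the dual side
   biorthogonality of direct summands turns the formula for [S_a^-] into the
   image of [E_V]. *)

Set Implicit Arguments.
Unset Strict Implicit.
Unset Printing Implicit Defensive.

(** * Residue fields and fibrewise split matrices *)

(** Points over an arbitrary [K]-algebra have no usable dimension count, so submodules are carried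
    by idempotent matrices and every exactness claim is a matrix identity with explicit witnesses;
    such identities survive any ring morphism. The correspondence between the two sides is then a
    relation, [linked], rather than a pair of maps: it is stable under base change and each of the
    two flags determines the other. Naturality of both maps and the two inverse laws follow at once
    from these two properties, so the work lies in producing a partner for a given point and in
    transferring the defining conditions across the relation. Ranks are compared only at
    field-valued points. A separate difficulty is that dimensions at equal vertices agree without
    being convertible; the rectangular identities [idm] absorb every such change of type. *)

Definition is_proper_ideal (R : comNzRingType) (I : set R) :=
  [/\ I 0, ~ I 1 & forall c u v, I u -> I v -> I (c * u + v)].

Lemma maximal_ideal_above (R : comNzRingType) (I : set R) :
  is_proper_ideal I ->
  exists J : set R, [/\ is_proper_ideal J, I `<=` J &
    forall x, ~ J x -> exists c, J (c * x - 1)].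
Proof.
move=> [I0 I1 Ilin].
(* The predicate is imposed on the union of [I] with [J], not on [J], so that it holds for the union
   of the empty chain. *)
have [F FP Ftot|J [PJ maxJ]] :=
  @Zorn_bigcup R (fun J => is_proper_ideal (I `|` J)).
  split; [by left | by case=> [//|[X FX X1]]; case: (FP _ FX) => _ []; right |].
  have sub X u : F X -> (I `|` X) u -> (I `|` \bigcup_(Y in F) Y) u.
    by move=> FX [Iu|Xu]; [left | right; exists X].
  have step X c u v : F X -> (I `|` X) u -> (I `|` X) v ->
      (I `|` \bigcup_(Y in F) Y) (c * u + v).
    move=> FX Xu Xv; apply: (sub X) => //.
    by case: (FP _ FX) => _ _; apply.
  move=> c u v [Iu|[X FX Xu]] [Iv|[Y FY Yv]].
  - by left; apply: Ilin.
  - by apply: (step Y c u v FY); [left | right].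
  - by apply: (step X c u v FX); [right | left].
  - by case: (Ftot X Y FX FY) => XY;
      [apply: (step Y c u v FY); right=> //; apply: XY
      |apply: (step X c u v FX); right=> //; apply: XY].
exists (I `|` J); split => [//|x Ix|]; first by left.
move=> x nJx; apply: contrapT => nex.
case: PJ => J0 J1 Jlin.
(* This is the ideal generated by [x] and the maximal one; if [x] had no inverse modulo the latter,
   it would be a strictly larger proper ideal. *)
pose J' := [set y | exists c, (I `|` J) (y - c * x)].
apply: (maxJ J').
  split.
    by move=> y Jy; exists 0; rewrite mul0r subr0; right.
  move=> /(_ x) H; apply: nJx; right; apply: H.
  by exists 1; rewrite mul1r subrr.
have J'E : I `|` J' = J'.
  apply/seteqP; split => y; last by right.
  by case=> // Iy; exists 0; rewrite mul0r subr0; left.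
rewrite J'E; split.
- by exists 0; rewrite mul0r subr0.
- move=> [c Hc]; apply: nex; exists c.
  by have := Jlin (-1) _ _ Hc J0; rewrite addr0 mulN1r opprB.
move=> b u v [c Hc] [e He]; exists (b * c + e).
have := Jlin b _ _ Hc He; rewrite mulrBr mulrDl mulrA.
by rewrite addrACA opprD.
Qed.

Section ResidueField.
Variables (R : comNzRingType) (J : set R).
Hypothesis Jideal : is_proper_ideal J.
Hypothesis Jmax : forall x, ~ J x -> exists c, J (c * x - 1).

Definition ideal_pred : R -> bool := fun x => `[< J x >].

Fact ideal_pred_closed : idealr_closed ideal_pred.
Proof.
case: Jideal => J0 J1 Jlin; split; first exact/asboolP.
  by apply/negP => /asboolP.
by move=> c u v /asboolP Ju /asboolP Jv; apply/asboolP/Jlin.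
Qed.

HB.instance Definition _ := isIdealr.Build R ideal_pred ideal_pred_closed.

Definition ideal_of_set : idealr R := Idealr.clone R ideal_pred _.
Definition residue_ring := {ideal_quot ideal_of_set}.
HB.instance Definition _ := GRing.ComNzRing.on residue_ring.

Local Notation pi := (\pi_residue_ring%qT : R -> residue_ring).

Lemma residue_eq0 (x : R) : J x -> pi x = 0.
Proof.
move=> Jx; rewrite -(rmorph0 pi); apply/eqP; rewrite -Quotient.idealrBE subr0.
exact/asboolP.
Qed.

Fact residue_inv_ex (x : residue_ring) : exists y, x != 0 -> y * x = 1.
Proof.
elim/quotW: x => x; change (exists y, pi x != 0 -> y * pi x = 1).
have [Jx|/Jmax[c Jc]] := pselect (J x).
  by exists 0 => /eqP[]; exact: residue_eq0.
exists (pi c) => _; apply/eqP; rewrite -subr_eq0 -rmorphM -(rmorph1 pi) -rmorphB.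
exact/eqP/residue_eq0.
Qed.

Definition residue_inv (x : residue_ring) : residue_ring :=
  if x == 0 then 0 else xget 0 [set y | y * x = 1].

Fact residue_mulVf (x : residue_ring) : x != 0 -> residue_inv x * x = 1.
Proof.
move=> x0; rewrite /residue_inv (negbTE x0).
have [y /(_ x0) yx] := residue_inv_ex x.
exact: (xgetPex 0 (ex_intro [set y | y * x = 1] y yx)).
Qed.

Fact residue_inv0 : residue_inv 0 = 0.
Proof. by rewrite /residue_inv eqxx. Qed.

HB.instance Definition _ :=
  GRing.ComNzRing_isField.Build residue_ring residue_mulVf residue_inv0.

Definition residue_field : fieldType := residue_ring.
Definition residue_map : {rmorphism R -> residue_field} := pi.

End ResidueField.

Lemma proper_ideal_field_point (R : comNzRingType) (I : set R) :
  is_proper_ideal I ->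
  exists (L : fieldType) (f : {rmorphism R -> L}), forall x, I x -> f x = 0.
Proof.
move=> /maximal_ideal_above[J [Jideal IJ Jmax]].
exists (residue_field Jideal Jmax), (residue_map Jideal Jmax) => x /IJ.
exact: (residue_eq0 Jideal).
Qed.

(** The scalars [c] such that [c%:M] is a left multiple of [A] form an ideal. If it were proper, it
    would vanish at some field-valued point; but some maximal minor of [A] is nonzero there, and by
    the adjugate formula every maximal minor belongs to the ideal. *)
Lemma fibrewise_left_invertible (R : comNzRingType) (p n : nat) (A : 'M[R]_(p, n)) :
  (forall (L : fieldType) (f : {rmorphism R -> L}),
     exists C, C *m map_mx f A = 1%:M) ->
  exists C, C *m A = 1%:M.
Proof.
move=> fib; pose I := [set c : R | exists C, C *m A = c%:M].
have [I1|nI1] := pselect (I 1); first exact: I1.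
have [|L [f fI]] := @proper_ideal_field_point R I.
  split => //; first by exists 0; rewrite mul0mx raddf0.
  move=> c u v [C HC] [D HD]; exists (c *: C + D).
  by rewrite mulmxDl -scalemxAl HC HD scale_scalar_mx -raddfD.
have [C HC] := fib L f.
have fullA : row_full (map_mx f A) by apply/row_fullP; exists C.
pose g := fullrankfun fullA.
have : \det (rowsub g (map_mx f A)) != 0.
  by rewrite -unitfE -unitmxE; have := fullrowsub_unit fullA.
rewrite -map_mxsub det_map_mx fI ?eqxx //.
exists (\adj (rowsub g A) *m rowsub g 1%:M).
by rewrite -mulmxA mul_rowsub_mx mul1mx mul_adj_mx.
Qed.

(** Stacking [A] on [1 - P] gives a matrix that is left invertible on every fibre, hence over [R];
    multiplying the resulting identity by [P] on the right removes the block of [1 - P]. *)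
Lemma fibrewise_left_factor (R : comNzRingType) (p n : nat)
    (A : 'M[R]_(p, n)) (P : 'M[R]_n) :
  P *m P = P -> A *m P = A ->
  (forall (L : fieldType) (f : {rmorphism R -> L}),
     exists s, s *m map_mx f A = map_mx f P) ->
  exists s, s *m A = P.
Proof.
move=> PP AP fib.
have [|C] := @fibrewise_left_invertible R _ _ (col_mx A (1%:M - P)).
  move=> L f; have [s Hs] := fib L f.
  exists (row_mx s 1%:M).
  by rewrite map_col_mx mul_row_col Hs mul1mx map_mxB map_mx1 addrC subrK.
rewrite -[C]hsubmxK mul_row_col => /(congr1 (mulmx^~ P)).
rewrite /= mulmxDl mul1mx -!mulmxA mulmxBl mul1mx PP subrr mulmx0 addr0 AP => H.
by exists (lsubmx C).
Qed.

(** * Images of idempotents and split exact sequences *)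

Definition row_image (R : nzRingType) (p n : nat) (A : 'M[R]_(p, n)) :
  set 'rV[R]_n := [set v | exists w, v = w *m A].

Lemma row_imageP (R : nzRingType) (n : nat) (P : 'M[R]_n) (v : 'rV_n) :
  P *m P = P -> row_image P v <-> v *m P = v.
Proof.
by move=> PP; split=> [[w ->]|<-]; [rewrite -mulmxA PP | exists v].
Qed.

Lemma row_image_eq (R : nzRingType) (n : nat) (P P' : 'M[R]_n) :
  P *m P = P -> P' *m P' = P' -> row_image P = row_image P' ->
  P *m P' = P /\ P' *m P = P'.
Proof.
move=> PP PP' E; split; apply/row_matrixP => i; rewrite row_mul.
  by apply/(row_imageP _ PP'); rewrite -E; exists (delta_mx 0 i); rewrite rowE.
by apply/(row_imageP _ PP); rewrite E; exists (delta_mx 0 i); rewrite rowE.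
Qed.

(** The columns of [1 - P] are annihilated by [P], and testing [y] on them gives [y = y *m P]. *)
Lemma orthogonal_orthogonal (R : comNzRingType) (n : nat) (P : 'M[R]_n) (y : 'rV_n) :
  P *m P = P ->
  (forall z : 'cV_n, P *m z = 0 -> y *m z = 0) <-> row_image P y.
Proof.
move=> PP; split=> [H|[w ->] z]; last by rewrite -mulmxA => ->; rewrite mulmx0.
apply/(row_imageP _ PP)/eqP; rewrite eq_sym -subr_eq0 -{1}[y]mulmx1 -mulmxBr.
apply/eqP/matrixP => i j; rewrite ord1.
have := H (col j (1%:M - P)).
rewrite colE mulmxA.
have -> : P *m (1%:M - P) = 0 by rewrite mulmxBr mulmx1 PP subrr.
by rewrite mul0mx mulmxA -colE => /(_ erefl)/matrixP/(_ 0 0); rewrite mxE => ->; rewrite !mxE.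
Qed.

(** Rewriting rule for products associated to the left, in which [A *m B] is not a subterm. *)
Lemma mulmx_tail (R : nzRingType) (n1 n2 n3 : nat) (A : 'M[R]_(n1, n2))
    (B : 'M_(n2, n3)) (D : 'M_(n1, n3)) : A *m B = D ->
  forall p (X : 'M_(p, n1)), X *m A *m B = X *m D.
Proof. by move=> E p X; rewrite -mulmxA E. Qed.

Lemma mulmx_tail2 (R : nzRingType) (n1 n2 n3 n4 : nat) (A : 'M[R]_(n1, n2))
    (B : 'M_(n2, n3)) (C : 'M_(n3, n4)) (D : 'M_(n1, n4)) : A *m B *m C = D ->
  forall p (X : 'M_(p, n1)), X *m A *m B *m C = X *m D.
Proof. by move=> E p X; rewrite -E !mulmxA. Qed.

(** Exactness is expressed by a contracting homotopy, so that base change preserves it without any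
    flatness argument. *)
Definition split_exact (R : nzRingType) (r N m : nat) (iota : 'M[R]_(r, N))
    (phi : 'M_(N, m)) (rho : 'M_(N, r)) (sigma : 'M_(m, N)) :=
  [/\ iota *m phi = 0, iota *m rho = 1%:M, sigma *m phi = 1%:M &
      rho *m iota + phi *m sigma = 1%:M].

(* [PV], [PE], [PU] project onto [V], [E], [U], with [V] the preimage of [E] under
   [iota] and [U] the image of [E] under [phi]; this is written as equations so
   that it is preserved by base change. *)
Definition adapted (R : nzRingType) (r N m : nat) (iota : 'M[R]_(r, N))
    (phi : 'M_(N, m)) (PE : 'M[R]_N) (PV : 'M[R]_r) (PU : 'M[R]_m) :=
  [/\ [/\ PE *m PE = PE, PV *m PV = PV & PU *m PU = PU],
      PE *m phi *m PU = PE *m phi,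
      exists s, s *m (PE *m phi) = PU,
      PV *m iota *m PE = PV *m iota &
      exists t, iota *m (1%:M - PE) *m t = 1%:M - PV].

Section BaseChange.
Variables (R S : nzRingType) (f : {rmorphism R -> S}) (r N m : nat).
Variables (iota : 'M[R]_(r, N)) (phi : 'M[R]_(N, m)).

Lemma split_exact_map rho sigma : split_exact iota phi rho sigma ->
  split_exact (map_mx f iota) (map_mx f phi) (map_mx f rho) (map_mx f sigma).
Proof.
by case=> ? ? ? ?; split; rewrite -!map_mxM -?map_mxD -?(map_mx1 f) -?(map_mx0 f);
  congr map_mx.
Qed.

Lemma adapted_map PE PV PU : adapted iota phi PE PV PU ->
  adapted (map_mx f iota) (map_mx f phi) (map_mx f PE) (map_mx f PV) (map_mx f PU).
Proof.
case=> [[PEE PVV PUU] EU [s Hs] VE [t Ht]].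
split; first (by split; rewrite -map_mxM; congr map_mx);
  try by rewrite -!map_mxM; congr map_mx.
- by exists (map_mx f s); rewrite -!map_mxM; congr map_mx.
- by exists (map_mx f t); rewrite -!(map_mx1 f) -!map_mxB -!map_mxM; congr map_mx.
Qed.

End BaseChange.

Section Adapted.
Variables (R : nzRingType) (r N m : nat).
Variables (iota : 'M[R]_(r, N)) (phi : 'M[R]_(N, m)).

Lemma adapted_sub PE PV PU v : adapted iota phi PE PV PU ->
  row_image PV v <-> row_image PE (v *m iota).
Proof.
case=> [[PEE PVV PUU] EU [s Hs] VE [t Ht]]; split.
  by move=> [w ->]; apply/(row_imageP _ PEE); rewrite (mulmx_tail2 VE) mulmxA.
move/(row_imageP _ PEE) => H; apply/(row_imageP _ PVV)/eqP.
rewrite eq_sym -subr_eq0 -{1}[v]mulmx1 -mulmxBr -Ht !mulmxA mulmxBr mulmx1 H.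
by rewrite subrr mul0mx.
Qed.

Lemma adapted_quot PE PV PU y : adapted iota phi PE PV PU ->
  row_image PU y <-> exists2 e, row_image PE e & y = e *m phi.
Proof.
case=> [[PEE PVV PUU] EU [s Hs] VE [t Ht]]; split.
  by move=> [w ->]; exists (w *m s *m PE); [exists (w *m s) | rewrite -Hs !mulmxA].
move=> [_ [w ->] ->]; exists (w *m PE *m phi).
by rewrite (mulmx_tail2 EU) mulmxA.
Qed.

Variables (rho : 'M[R]_(N, r)) (sigma : 'M[R]_(m, N)).
Hypothesis exact_seq : split_exact iota phi rho sigma.

Let iota_phi : iota *m phi = 0. Proof. by case: exact_seq. Qed.
Let iota_rho : iota *m rho = 1%:M. Proof. by case: exact_seq. Qed.
Let sigma_phi : sigma *m phi = 1%:M. Proof. by case: exact_seq. Qed.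
Let rho_iota : rho *m iota = 1%:M - phi *m sigma.
Proof. by case: exact_seq => _ _ _ <-; rewrite addrK. Qed.
Let phi_sigma : phi *m sigma = 1%:M - rho *m iota.
Proof. by rewrite rho_iota opprB addrC subrK. Qed.

Lemma kernel_summand PE PU s : PE *m PE = PE -> PU *m PU = PU ->
  PE *m phi *m PU = PE *m phi -> s *m (PE *m phi) = PU ->
  exists PV, adapted iota phi PE PV PU.
Proof.
move=> PEE PUU EU Hs; have Hs' := Hs; rewrite mulmxA in Hs'.
(* Since [s *m PE] is a section of [E -> U], [T] projects onto the kernel of [phi] in [E]. It
   therefore factors through [iota], and conjugating by [iota] and [rho] gives [PV]. *)
pose T := PE - PE *m phi *m s *m PE.
have Tphi : T *m phi = 0.
  by rewrite mulmxBl (mulmx_tail2 Hs') EU subrr.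
have Tri : T *m rho *m iota = T.
  by rewrite (mulmx_tail rho_iota) mulmxBr mulmx1 mulmxA Tphi mul0mx subr0.
have TE : T *m PE = T by rewrite mulmxBl (mulmx_tail PEE) PEE.
have TT : T *m T = T.
  by rewrite {2}/T mulmxBr TE !mulmxA TE Tphi !mul0mx subr0.
exists (iota *m T *m rho); split => //.
- by split => //; rewrite !mulmxA (mulmx_tail2 Tri) (mulmx_tail TT).
- by exists s.
- by rewrite (mulmx_tail2 Tri) (mulmx_tail TE).
(* The product of [1 - PE] and [1 - phi *m s *m PE] is [1 - T - phi *m s *m PE], whose last term is
   killed by [iota] on the left. *)
exists (rho - phi *m s *m PE *m rho).
rewrite /T !(mulmxBr, mulmxBl, mulmxA, mulmx1, mul1mx) iota_phi iota_rho.
rewrite !mul0mx sub0r.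
by rewrite opprK opprB addrA addrAC.
Qed.

(** Through [t], a complement of [V] splits off from a complement of [E]. What remains is a
    complement of the sum of [E] and the image of [iota], and it maps isomorphically onto a
    complement of the image of [E] under [phi]. *)
Lemma quotient_summand PE PV t : PE *m PE = PE -> PV *m PV = PV ->
  PV *m iota *m PE = PV *m iota -> iota *m (1%:M - PE) *m t = 1%:M - PV ->
  exists PU, adapted iota phi PE PV PU.
Proof.
move=> PEE PVV VE Ht.
(* The normalised [t'] vanishes on [E] and takes values in the image of [1 - PV]; this is what makes
   [C] below idempotent. *)
pose Q := 1%:M - PE; pose t' := Q *m t *m (1%:M - PV).
have QQ : Q *m Q = Q by rewrite mulmxBr mulmx1 mulmxBl mul1mx PEE subrr subr0.
have EQ : PE *m Q = 0 by rewrite mulmxBr mulmx1 PEE subrr.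
have QVV : (1%:M - PV) *m (1%:M - PV) = 1%:M - PV.
  by rewrite mulmxBr mulmx1 mulmxBl mul1mx PVV subrr subr0.
have Qt : Q *m t' = t' by rewrite !mulmxA QQ.
have iQt : iota *m Q *m t' = 1%:M - PV.
  by rewrite !mulmxA (mulmx_tail QQ) Ht.
have it : iota *m t' = 1%:M - PV by rewrite -Qt mulmxA iQt.
have VQ : PV *m iota *m Q = 0 by rewrite mulmxBr mulmx1 VE subrr.
have tV : t' *m PV = 0.
  have V0 : (1%:M - PV) *m PV = 0 by rewrite mulmxBl mul1mx PVV subrr.
  by rewrite -mulmxA V0 mulmx0.
have QE : Q = 1%:M - PE by [].
clearbody t' Q.
(* [C] vanishes on [E] and on the image of [iota], so it factors through [phi]. *)
pose C := Q - t' *m iota *m Q.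
have EC : PE *m C = 0 by rewrite mulmxBr EQ -Qt !mulmxA EQ !mul0mx subr0.
have iC : iota *m C = 0.
  by rewrite mulmxBr !mulmxA it !mulmxBl mul1mx VQ subr0 subrr.
have CC : C *m C = C.
  rewrite {2}/C mulmxBr; have -> : C *m Q = C by rewrite mulmxBl QQ (mulmx_tail QQ).
  by rewrite !mulmxA [C *m t']mulmxBl Qt (mulmx_tail2 iQt) mulmxBr mulmx1 tV subr0
    subrr !mul0mx subr0.
have rC : phi *m sigma *m C = C.
  by rewrite phi_sigma mulmxBl mul1mx -mulmxA iC mulmx0 subr0.
have Cphi : (1%:M - sigma *m C *m phi) = (sigma - sigma *m t' *m iota) *m (PE *m phi).
  rewrite /C QE !(mulmxBr, mulmxBl, mulmxA, mulmx1, mul1mx) sigma_phi.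
  by rewrite (mulmx_tail iota_phi) mulmx0 sub0r opprK opprD opprB addrA addrCA subrr addr0.
(* [sigma *m C *m phi] is the idempotent that [C] induces on the quotient; its kernel is the image
   of [E], so its complement projects onto that image. *)
exists (1%:M - sigma *m C *m phi); split => //.
- split => //.
  rewrite mulmxBr mulmx1 mulmxBl mul1mx !mulmxA.
  by rewrite (mulmx_tail2 rC) (mulmx_tail CC) subrr subr0.
- rewrite mulmxBr mulmx1 !mulmxA (mulmx_tail2 rC).
  by rewrite EC mul0mx subr0.
- by exists (sigma - sigma *m t' *m iota).
- by exists t.
Qed.

End Adapted.

(** Rank-nullity for [phi] restricted to [E]: the image is [U], and the kernel is the image of [V]
    under the injective [iota]. *)
Lemma adapted_rank (L : fieldType) (r N m : nat) (iota : 'M[L]_(r, N))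
    (phi : 'M_(N, m)) (rho : 'M_(N, r)) (sigma : 'M_(m, N)) PE PV PU :
  split_exact iota phi rho sigma -> adapted iota phi PE PV PU ->
  \rank PE = (\rank PV + \rank PU)%N.
Proof.
move=> [ip ir _ exN] [[PEE PVV PUU] EU [s Hs] VE [t Ht]].
have -> : \rank PU = \rank (PE *m phi).
  by apply/eqmx_rank/andP; split; [rewrite -Hs submxMl | rewrite -EU submxMl].
have free_iota : row_free iota by apply/row_freeP; exists rho.
rewrite -(mxrankMfree PV free_iota) -(mxrank_mul_ker PE phi) addnC; congr addn.
apply/eqmx_rank/andP; split; last first.
  rewrite sub_capmx -{1}VE submxMl; apply/sub_kermxP.
  by rewrite -mulmxA ip mulmx0.
set X := (_ :&: _)%MS.
have XE : X *m PE = X.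
  have /submxP[Y HY] : (X <= PE)%MS by exact: capmxSl.
  by rewrite HY -mulmxA PEE.
have Xphi : X *m phi = 0 by apply/sub_kermxP; exact: capmxSr.
have Xri : X *m rho *m iota = X.
  by rewrite -[RHS]mulmx1 -exN mulmxDr !mulmxA Xphi mul0mx addr0.
have XV : X *m rho *m PV = X *m rho.
  apply/eqP; rewrite eq_sym -subr_eq0 -{1}[X *m rho]mulmx1 -mulmxBr -Ht !mulmxA Xri.
  by rewrite mulmxBr mulmx1 XE subrr mul0mx.
by rewrite -Xri -XV -mulmxA submxMl.
Qed.

Lemma fibrewise_kernel_summand (R : comNzRingType) (r N m : nat)
    (iota : 'M[R]_(r, N)) (phi : 'M_(N, m)) (rho : 'M_(N, r)) (sigma : 'M_(m, N))
    PE PU :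
  split_exact iota phi rho sigma -> PE *m PE = PE -> PU *m PU = PU ->
  PE *m phi *m PU = PE *m phi ->
  (forall (L : fieldType) (f : {rmorphism R -> L}),
     (map_mx f PU <= map_mx f PE *m map_mx f phi)%MS) ->
  exists PV, adapted iota phi PE PV PU.
Proof.
move=> ex PEE PUU EU fib.
have [|s Hs] := fibrewise_left_factor PUU EU.
  by move=> L f; have /submxP[s ->] := fib L f; exists s; rewrite map_mxM.
exact: (kernel_summand ex PEE PUU EU Hs).
Qed.

(** The fibre condition says that [iota] induces an injection modulo [V] and [E]. Splitting it
    requires a right factor, which [fibrewise_left_factor] yields after transposition. *)
Lemma fibrewise_quotient_summand (R : comNzRingType) (r N m : nat)
    (iota : 'M[R]_(r, N)) (phi : 'M_(N, m)) (rho : 'M_(N, r)) (sigma : 'M_(m, N))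
    PE PV :
  split_exact iota phi rho sigma -> PE *m PE = PE -> PV *m PV = PV ->
  PV *m iota *m PE = PV *m iota ->
  (forall (L : fieldType) (f : {rmorphism R -> L}) w,
     row_image (map_mx f PE) (w *m map_mx f iota) -> row_image (map_mx f PV) w) ->
  exists PU, adapted iota phi PE PV PU.
Proof.
move=> ex PEE PVV VE fib; pose Q := 1%:M - PE; pose A := (1%:M - PV) *m iota *m Q.
have QVV : (1%:M - PV) *m (1%:M - PV) = 1%:M - PV.
  by rewrite mulmxBr mulmx1 mulmxBl mul1mx PVV subrr subr0.
have VQ : PV *m iota *m Q = 0 by rewrite mulmxBr mulmx1 VE subrr.
have AE : A = iota *m Q by rewrite /A !mulmxBl mul1mx VQ subr0.
have [|||t] := @fibrewise_left_factor R _ _ A^T (1%:M - PV)^T.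
- by rewrite -trmx_mul QVV.
- by rewrite -trmx_mul; congr trmx; rewrite /A !mulmxA QVV.
- move=> L f.
  have : (map_mx f (1%:M - PV)^T <= map_mx f A^T)%MS.
    rewrite -!map_trmx submxE; apply/eqP.
    (* The rows of [c^T] are killed by [iota *m Q], so [iota] maps them into [E]; by the fibre
       condition they lie in [V], where [1 - PV] vanishes. *)
    set c := cokermx _.
    have cA : c^T *m map_mx f A = 0.
      by rewrite -[map_mx f A]trmxK -trmx_mul mulmx_coker trmx0.
    apply: trmx_inj; rewrite trmx_mul trmxK trmx0.
    apply/row_matrixP => i; rewrite row_mul row0.
    have : row_image (map_mx f PV) (row i c^T).
      apply: fib; apply/row_imageP; first by rewrite -map_mxM PEE.
      have := congr1 (row i) cA; rewrite row_mul row0 AE map_mxM /Q map_mxB map_mx1.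
      by rewrite mulmxA mulmxBr mulmx1 => /eqP; rewrite subr_eq0 => /eqP.
    move/(row_imageP _ (etrans (esym (map_mxM f _ _)) (congr1 _ PVV))) => H.
    by rewrite map_mxB map_mx1 mulmxBr mulmx1 H subrr.
  by move/submxP => [s Hs]; exists s.
move/(congr1 trmx); rewrite trmx_mul !trmxK AE => Ht.
exact: (quotient_summand ex PEE PVV VE Ht).
Qed.

(** * The direct sum over the arrows ending at a vertex *)

(* Used with [m = n] provable but not by conversion, in place of [castmx]. *)
Definition idm (R : nzRingType) (m n : nat) : 'M[R]_(m, n) :=
  \matrix_(i, j) (i == j :> nat)%:R.
Arguments idm {R} m n.

Section Idm.
Variable R : nzRingType.

Lemma idm1 n : idm n n = 1%:M :> 'M[R]_n.
Proof. by apply/matrixP => i j; rewrite !mxE. Qed.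

Lemma idm_comp m n p : m = n -> idm m n *m idm n p = idm m p :> 'M[R]_(m, p).
Proof. by move=> <-; rewrite idm1 mul1mx. Qed.

Lemma idm_compr m n p : n = p -> idm m n *m idm n p = idm m p :> 'M[R]_(m, p).
Proof. by move=> <-; rewrite idm1 mulmx1. Qed.

Lemma idmK m n : m = n -> idm m n *m idm n m = 1%:M :> 'M[R]_m.
Proof. by move=> e; rewrite idm_comp // idm1. Qed.

Lemma tr_idm m n : (idm m n)^T = idm n m :> 'M[R]_(n, m).
Proof. by apply/matrixP => i j; rewrite !mxE eq_sym. Qed.

Lemma map_idm (S : nzRingType) (f : {rmorphism R -> S}) m n :
  map_mx f (idm m n) = idm m n.
Proof. by apply/matrixP => i j; rewrite !mxE rmorph_nat. Qed.

Lemma castmx_idm m n m' n' (e : (m = m') * (n = n')) (A : 'M[R]_(m, n)) :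
  castmx e A = idm m' m *m A *m idm n n'.
Proof.
case: e => em en; case: m' / em; case: n' / en.
by rewrite castmx_id !idm1 mul1mx mulmx1.
Qed.

Lemma subfamily_idm (Q0 : finType) (n : Q0 -> nat) (W : subfamily R n) i j :
  i = j -> forall u, W j (u *m idm (n i) (n j)) <-> W i u.
Proof. by move=> <- u; rewrite idm1 mulmx1. Qed.

Lemma Tagged_idm (Q0 : finType) (n : Q0 -> nat) i j (u : 'rV[R]_(n i)) (v : 'rV_(n j)) :
  Tagged (fun i => 'rV[R]_(n i)) u = Tagged (fun i => 'rV[R]_(n i)) v <->
  i = j /\ v = u *m idm (n i) (n j).
Proof.
split=> [H|[ij ->]].
  have ij := congr1 tag H; split=> //=; rewrite /= in ij.
  move: v H; rewrite -ij => v /eqP; rewrite eq_Tagged /= => /eqP ->.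
  by rewrite idm1 mulmx1.
by move: v; rewrite -ij idm1 mulmx1.
Qed.

End Idm.

Section InProj.
Variables (Q0 Q1 : finType) (Q : quiver Q0 Q1) (n : Q0 -> nat) (a : Q0).

Local Notation N := #|in_coord Q n a|.
Local Notation proj R al := (in_proj R Q n a al).
Local Notation tag_coord al := (Tagged (fun be => 'I_(n (src Q be))) (i := al)).

Section Ring.
Variable R : nzRingType.

(** The transposed projections are the inclusions of the summands; this lemma and the next two are
    the biproduct relations. *)
Lemma proj_tr_proj al : tgt Q al = a -> (proj R al)^T *m proj R al = 1%:M.
Proof.
move=> ta; apply/matrixP => x y; rewrite !mxE.
pose c : in_coord Q n a := exist _ (tag_coord al x) (introT eqP ta).
rewrite (bigD1 (enum_rank c)) //= !mxE enum_rankK eqxx mul1r.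
rewrite eq_Tagged /= big1 ?addr0 // => k kc; rewrite !mxE.
case: eqP => [E|]; last by rewrite mul0r.
by move: kc; rewrite -(inj_eq enum_val_inj) enum_rankK -(inj_eq val_inj) E eqxx.
Qed.

Lemma proj_tr_proj0 al be : al != be -> (proj R al)^T *m proj R be = 0.
Proof.
move=> ab; apply/matrixP => x y; rewrite !mxE big1 // => k _; rewrite !mxE.
case: eqP => [->|]; last by rewrite mul0r.
case: eqP => [E|]; last by rewrite mulr0.
by move: ab; rewrite (congr1 tag E : al = be) eqxx.
Qed.

Lemma proj_sum : \sum_(al | tgt Q al == a) proj R al *m (proj R al)^T = 1%:M.
Proof.
apply/matrixP => k l; rewrite summxE mxE.
case Ek : (enum_val k) => [[al x] ta].
rewrite (bigD1 al) //= [X in _ + X]big1 ?addr0 => [|be /andP[_ ba]]; last first.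
  rewrite !mxE big1 // => y _; rewrite !mxE Ek /=; case: eqP => [E|]; last by rewrite mul0r.
  by move: ba; rewrite (congr1 tag E : al = be) eqxx.
rewrite mxE (bigD1 x) //= !mxE Ek /= eqxx mul1r.
rewrite [X in _ + X]big1 ?addr0 => [|y yx]; last first.
  by rewrite !mxE Ek eq_Tagged /= eq_sym (negbTE yx) mul0r.
congr (_%:R); congr nat_of_bool.
by rewrite -(inj_eq enum_val_inj) -(inj_eq val_inj) Ek eq_sym.
Qed.

Lemma row_proj_sum p (y : 'M_(p, N)) :
  y = \sum_(al | tgt Q al == a) y *m proj R al *m (proj R al)^T.
Proof.
rewrite -{1}[y]mulmx1 -proj_sum mulmx_sumr.
by apply: eq_bigr => al _; rewrite mulmxA.
Qed.

Lemma map_proj (S : nzRingType) (f : {rmorphism R -> S}) al :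
  map_mx f (proj R al) = proj S al.
Proof. by apply/matrixP => x y; rewrite !mxE rmorph_nat. Qed.

Lemma phi_sum (X : rep R Q n) :
  phi a X = \sum_(al | tgt Q al == a) proj R al *m X al *m idm (n (tgt Q al)) (n a).
Proof.
rewrite (big_sub (fun al => tgt Q al == a)
  (fun al => proj R al *m X al *m idm (n (tgt Q al)) (n a))).
by apply: eq_bigr => al _; rewrite castmx_idm idm1 mul1mx mulmxA.
Qed.

Lemma proj_tr_phi (X : rep R Q n) al : tgt Q al = a ->
  (proj R al)^T *m phi a X = X al *m idm (n (tgt Q al)) (n a).
Proof.
move=> ta; rewrite phi_sum mulmx_sumr (bigD1 al) ?ta //= big1 ?addr0.
  by rewrite !mulmxA proj_tr_proj // mul1mx.
move=> be /andP[_ ba]; rewrite !mulmxA proj_tr_proj0 ?mul0mx //.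
by rewrite eq_sym.
Qed.

(** The block diagonal idempotent projecting onto [E_U], when each [P i] projects onto [U_i]. *)
Definition block_sum (P : forall i, 'M[R]_(n i)) : 'M[R]_N :=
  \sum_(al | tgt Q al == a) proj R al *m P (src Q al) *m (proj R al)^T.

Lemma block_sum_proj P al : tgt Q al = a ->
  block_sum P *m proj R al = proj R al *m P (src Q al).
Proof.
move=> ta; rewrite mulmx_suml (bigD1 al) ?ta //= big1 ?addr0.
  by rewrite -mulmxA proj_tr_proj // mulmx1.
by move=> be /andP[_ ba]; rewrite -mulmxA proj_tr_proj0 ?mulmx0.
Qed.

Lemma block_sum_idem P : (forall i, P i *m P i = P i) ->
  block_sum P *m block_sum P = block_sum P.
Proof.
move=> PP; rewrite {2}/block_sum mulmx_sumr; apply: eq_bigr => al /eqP ta.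
by rewrite !mulmxA block_sum_proj // (mulmx_tail (PP _)).
Qed.

Lemma row_image_block_sum P y : (forall i, P i *m P i = P i) ->
  row_image (block_sum P) y <->
  forall al, tgt Q al = a -> row_image (P (src Q al)) (y *m proj R al).
Proof.
move=> PP; split=> [[w ->] al ta|H].
  by exists (w *m proj R al); rewrite -!mulmxA block_sum_proj.
apply/row_imageP; first exact: block_sum_idem.
rewrite [RHS]row_proj_sum mulmx_sumr; apply: eq_bigr => al /eqP ta.
by rewrite !mulmxA; congr (_ *m _); apply/row_imageP; [exact: PP | exact: H].
Qed.

End Ring.

Lemma map_block_sum (R S : nzRingType) (f : {rmorphism R -> S}) P :
  map_mx f (block_sum P) = block_sum (fun i => map_mx f (P i)).
Proof.
rewrite [LHS](big_morph _ (@map_mxD _ _ f _ _) (map_mx0 f _ _)); apply: eq_bigr => al _.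
by rewrite !map_mxM -map_trmx map_proj.
Qed.

Lemma rank_idem_add (L : fieldType) p (A B : 'M[L]_p) :
  A *m A = A -> B *m B = B -> A *m B = 0 -> B *m A = 0 ->
  \rank (A + B)%R = (\rank A + \rank B)%N.
Proof.
move=> AA BB AB BA; apply/eqP; rewrite eqn_leq mxrank_add /=.
rewrite -mxrank_disjoint_sum; last first.
  apply/eqP; rewrite -submx0; apply/rV_subP => v; rewrite sub_capmx.
  move=> /andP[/submxP[x vA] /submxP[y vB]].
  have -> : v = 0 by rewrite vA -AA mulmxA -vA vB -mulmxA BA mulmx0.
  exact: sub0mx.
apply: mxrankS; rewrite addsmx_sub; apply/andP; split.
  by rewrite -{1}AA -[A *m A]addr0 -AB -mulmxDr submxMl.
by rewrite -{1}BB -[B *m B]add0r -BA -mulmxDr submxMl.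
Qed.

Lemma rank_block_sum (L : fieldType) (P : forall i, 'M[L]_(n i)) :
  (forall i, P i *m P i = P i) ->
  \rank (block_sum P) = (\sum_(al | tgt Q al == a) \rank (P (src Q al)))%N.
Proof.
move=> PP; pose A al := proj L al *m P (src Q al) *m (proj L al)^T.
have rankA al : tgt Q al = a -> \rank (A al) = \rank (P (src Q al)).
  move=> ta.
  have free : row_free (proj L al)^T by apply/row_freeP; exists (proj L al); exact: proj_tr_proj.
  by rewrite mxrankMfree // -mxrank_tr trmx_mul mxrankMfree // mxrank_tr.
have AA al : tgt Q al = a -> A al *m A al = A al.
  by move=> ta; rewrite /A !mulmxA (mulmx_tail (proj_tr_proj _ ta)) mulmx1 (mulmx_tail (PP _)).
have A0 al be : al != be -> A al *m A be = 0.
  by move=> ab; rewrite /A !mulmxA (mulmx_tail (proj_tr_proj0 _ ab)) mulmx0 !mul0mx.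
rewrite /block_sum -/A.
(* Idempotence of the partial sums joins the induction, because ranks of two orthogonal idempotents
   add; uniqueness of the enumeration supplies the orthogonality. *)
suff [] : (\sum_(al <- index_enum Q1 | tgt Q al == a) A al) *m
    (\sum_(al <- index_enum Q1 | tgt Q al == a) A al) =
    \sum_(al <- index_enum Q1 | tgt Q al == a) A al /\
  \rank (\sum_(al <- index_enum Q1 | tgt Q al == a) A al)%R =
  (\sum_(al <- index_enum Q1 | tgt Q al == a) \rank (P (src Q al)))%N by [].
elim: (index_enum Q1) (index_enum_uniq Q1) => [_|be s IH /= /andP[bes us]].
  by rewrite !big_nil mxrank0 mul0mx.
have [IHA IHr] := IH us; rewrite !big_cons; case: eqP => // tb.
set S := \sum_(j <- s | _) A j.
have bS : A be *m S = 0.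
  rewrite mulmx_sumr big_seq_cond big1 // => al /andP[als _]; rewrite A0 //.
  by apply: contraNneq bes => ->.
have Sb : S *m A be = 0.
  rewrite mulmx_suml big_seq_cond big1 // => al /andP[als _]; rewrite A0 //.
  by apply: contraNneq bes => <-.
split; last by rewrite rank_idem_add ?AA // rankA // IHr.
by rewrite mulmxDl !mulmxDr bS Sb addr0 add0r IHA AA.
Qed.

End InProj.

(** * The reflection at a sink in matrix form *)

Lemma tr_proj_block_sum (Q0 Q1 : finType) (Q : quiver Q0 Q1) (n : Q0 -> nat) (a : Q0)
    (R : nzRingType) (P : forall i, 'M[R]_(n i)) al : tgt Q al = a ->
  (in_proj R Q n a al)^T *m block_sum Q a P = P (src Q al) *m (in_proj R Q n a al)^T.
Proof.
move=> ta; rewrite mulmx_sumr (bigD1 al) ?ta //= big1 ?addr0.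
  by rewrite !mulmxA proj_tr_proj // mul1mx.
by move=> be /andP[_ ba]; rewrite !mulmxA proj_tr_proj0 ?mul0mx // eq_sym.
Qed.

Section SinkReflection.
Variables (K : fieldType) (Q0 Q1 : finType) (Q : quiver Q0 Q1) (n : Q0 -> nat).
Variables (a : Q0) (X : rep K Q n).

Lemma sink_dim_neq i : i != a -> sink_dim a X i = n i.
Proof. by rewrite /sink_dim => /negbTE ->. Qed.

Lemma sink_dim_eq : sink_dim a X a = ker_dim a X.
Proof. by rewrite /sink_dim eqxx. Qed.

(** The kernel inclusion, typed with the dimension that the reflected representation has at [a]; it
    is locked to keep it opaque during computation with matrices. *)
Definition iota_mx : 'M[K]_(sink_dim a X a, #|in_coord Q n a|) :=
  locked (idm _ _ *m ker_incl a X).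

Lemma iota_mxE : iota_mx = idm _ _ *m ker_incl a X.
Proof. by rewrite /iota_mx -lock. Qed.

Lemma sink_flag_neq nu (R : comAlgType K) (U : flag nu R n) k i v : i != a ->
  (sink_flag (X := X) (a := a) U) k i v <-> U k i (v *m idm _ _).
Proof.
move=> /negbTE ia; move: v; rewrite /sink_flag /sink_dim ia => v.
by rewrite idm1 mulmx1.
Qed.

Lemma sink_flag_eq nu (R : comAlgType K) (U : flag nu R n) k v :
  (sink_flag (X := X) (a := a) U) k a v <->
  forall al, tgt Q al = a ->
    U k (src Q al) (v *m map_mx (in_alg R) iota_mx *m in_proj R Q n a al).
Proof.
have -> : iota_mx = castmx (esym sink_dim_eq, erefl) (ker_incl a X).
  by rewrite castmx_idm idm1 mulmx1 iota_mxE.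
move: (esym sink_dim_eq) v; rewrite /sink_flag /sink_dim eqxx => e v.
rewrite castmx_id; split=> H al ta; have := H al ta;
  by rewrite ?mulmxA.
Qed.

(** Together with [sink_reflection_neq], this trades the dependent matches of the definition for
    plain matrix products. *)
Lemma sink_reflection_eq al : tgt Q al = a -> src Q al != a ->
  sink_reflection a X al = idm _ _ *m iota_mx *m in_proj K Q n a al *m idm _ _.
Proof.
move=> ta sa; rewrite iota_mxE.
rewrite [idm _ _ *m (idm _ _ *m _)]mulmxA idm_compr ?sink_dim_eq //.
have at_a : at_vertex Q a al = true by rewrite /at_vertex ta eqxx orbT.
have tb : (tgt Q al == a) = true by rewrite ta eqxx.
rewrite /sink_reflection /sink_dim /reflect_quiver /=.
rewrite at_a tb (negbTE sa).
by rewrite !idm1 mul1mx mulmx1.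
Qed.

Lemma sink_reflection_neq al : tgt Q al != a -> src Q al != a ->
  sink_reflection a X al = idm _ _ *m X al *m idm _ _.
Proof.
move=> ta sa; have at_a : at_vertex Q a al = false.
  by rewrite /at_vertex (negbTE ta) (negbTE sa).
rewrite /sink_reflection /sink_dim /reflect_quiver /=.
rewrite at_a (negbTE ta) (negbTE sa).
by rewrite !idm1 mul1mx mulmx1.
Qed.



(** A section [sigma] of [phi] determines [rho]: the rows of [1 - phi *m sigma] lie in the kernel,
    so they factor through [iota_mx]. That [rho] retracts [iota_mx] is checked after composing with
    the injective [iota_mx]. *)
Lemma split_exact_iota : row_full (phi a X) ->
  exists rho sigma, split_exact iota_mx (phi a X) rho sigma.
Proof.
move=> /row_fullP[sigma Hs].
have iota_phi : iota_mx *m phi a X = 0.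
  rewrite iota_mxE -mulmxA.
  have /sub_kermxP -> : (ker_incl a X <= kermx (phi a X))%MS by rewrite eq_row_base.
  by rewrite mulmx0.
have /submxP[rho' Hr] : (1%:M - phi a X *m sigma <= ker_incl a X)%MS.
  by rewrite eq_row_base; apply/sub_kermxP; rewrite mulmxBl mul1mx (mulmx_tail Hs) mulmx1 subrr.
pose rho := rho' *m idm (ker_dim a X) (sink_dim a X a).
have rho_iota : rho *m iota_mx = 1%:M - phi a X *m sigma.
  by rewrite Hr /rho iota_mxE !mulmxA (mulmx_tail (idmK _ _)) ?mulmx1 ?sink_dim_eq.
exists rho, sigma; split=> //; last by rewrite rho_iota subrK.
have free : row_free iota_mx.
  rewrite /row_free iota_mxE; apply/eqP.
  rewrite mxrankMfree; last exact: row_base_free.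
  have rank_idm u v : u = v -> \rank (idm u v : 'M[K]_(u, v)) = u.
    by move=> <-; rewrite idm1 mxrank1.
  by rewrite rank_idm // sink_dim_eq.
apply: (row_free_inj free).
by rewrite -mulmxA rho_iota mulmxBr mulmxA iota_phi mul0mx subr0 mul1mx mulmx1.
Qed.

End SinkReflection.

(** * The vertex space of the double reflection at the sink *)

Section Identification.
Variables (K : fieldType) (Q0 Q1 : finType) (Q : quiver Q0 Q1) (n : Q0 -> nat).
Variables (a : Q0) (X : rep K Q n).
Hypothesis sink_a : is_sink Q a.

Local Notation P := (reflect_quiver a Q).
Local Notation Y := (sink_reflection a X).
Local Notation DY := (dual_rep (sink_reflection a X)).

(** In [op P] the arrows at [a] regain their direction and all others are reversed, so [a] is again
    a sink and the reflection applies to the dual of [Y]. *)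
Lemma tgt_reflect_op al : (tgt (op P) al == a) = (tgt Q al == a).
Proof.
rewrite /= /at_vertex (negbTE (sink_a al)) /=.
by case E: (tgt Q al == a); rewrite ?E ?(negbTE (sink_a al)).
Qed.

Lemma src_reflect_op al : src (op P) al = src Q al \/ tgt Q al != a.
Proof.
rewrite /= /at_vertex (negbTE (sink_a al)) /=.
by case: eqP => ta; [left | right].
Qed.

Lemma src_reflect_op_eq al : tgt Q al = a -> src (op P) al = src Q al.
Proof. by move=> ta; case: (src_reflect_op al) => //; rewrite ta eqxx. Qed.

Lemma src_reflect_op_neq al : tgt Q al != a -> src (op P) al = tgt Q al.
Proof. by rewrite /= /at_vertex (negbTE (sink_a al)) /= => /negbTE ->. Qed.

Lemma tgt_reflect_op_neq al : tgt Q al != a -> tgt (op P) al = src Q al.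
Proof. by rewrite /= /at_vertex (negbTE (sink_a al)) /= => /negbTE ->. Qed.

Lemma sink_dim_src al : tgt Q al = a -> sink_dim a X (src (op P) al) = n (src Q al).
Proof. by move=> ta; rewrite src_reflect_op_eq // sink_dim_neq. Qed.

(** The kernel of [phi a DY] is the annihilator of the image of [iota_mx a X], so its dual is a
    cokernel of [iota_mx a X]. Since [phi a X] is another one, the two are canonically isomorphic,
    compatibly with the arrows into [a]. *)
Lemma identification_at_sink rho sigma :
  split_exact (iota_mx a X) (phi a X) rho sigma ->
  exists (theta : 'M_(sink_dim a DY a, n a)) zeta,
    [/\ theta *m zeta = 1%:M, zeta *m theta = 1%:M &
      forall al, tgt Q al = a ->
        idm (n (src Q al)) (sink_dim a X (src (op P) al)) *m
          (in_proj K (op P) (sink_dim a X) a al)^T *m (iota_mx a DY)^T *m theta =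
        X al *m idm (n (tgt Q al)) (n a)].
Proof.
move=> [ip ir sp ex].
pose p al := in_proj K Q n a al.
pose p' al := in_proj K (op P) (sink_dim a X) a al.
pose c al : 'M[K]_(sink_dim a X (src (op P) al), n (src Q al)) := idm _ _.
(* [J] identifies the two copies of the direct sum, formed over [op P] and over [Q]; it is
   orthogonal. *)
pose J := \sum_(al | tgt Q al == a) p' al *m c al *m (p al)^T.
have cct al : tgt Q al = a -> c al *m (c al)^T = 1%:M.
  by move=> ta; rewrite /c tr_idm idmK // sink_dim_src.
have ctc al : tgt Q al = a -> (c al)^T *m c al = 1%:M.
  by move=> ta; rewrite /c tr_idm idmK // sink_dim_src.
have pp al : tgt Q al = a -> (p al)^T *m p al = 1%:M by exact: proj_tr_proj.
have pp' al : tgt Q al = a -> (p' al)^T *m p' al = 1%:M.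
  by move=> ta; apply: proj_tr_proj; apply/eqP; rewrite tgt_reflect_op ta.
have Jp al : tgt Q al = a -> J *m p al = p' al *m c al.
  move=> ta; rewrite mulmx_suml (bigD1 al) ?ta //= big1 ?addr0.
    by rewrite (mulmx_tail (pp _ ta)) mulmx1.
  by move=> be /andP[_ ba]; rewrite (mulmx_tail (proj_tr_proj0 _ _ _ _ ba)) mulmx0.
have pJ al : tgt Q al = a -> (p' al)^T *m J = c al *m (p al)^T.
  move=> ta; rewrite mulmx_sumr (bigD1 al) ?ta //= big1 ?addr0.
    by rewrite !mulmxA pp' // mul1mx.
  by move=> be /andP[_ ba]; rewrite !mulmxA proj_tr_proj0 ?mul0mx // eq_sym.
have JJt : J *m J^T = 1%:M.
  rewrite -(proj_sum (op P) (sink_dim a X) a K) {1}/J mulmx_suml.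
  apply: eq_big => [al|al /eqP ta]; first by rewrite tgt_reflect_op.
  by rewrite -mulmxA -trmx_mul Jp // trmx_mul mulmxA (mulmx_tail (cct _ ta)) mulmx1.
have JtJ : J^T *m J = 1%:M.
  rewrite -(proj_sum Q n a K) {2}/J mulmx_sumr.
  apply: eq_bigr => al /eqP ta.
  have -> : J^T *m (p' al *m c al *m (p al)^T) = ((p' al)^T *m J)^T *m c al *m (p al)^T.
    by rewrite trmx_mul trmxK !mulmxA.
  by rewrite pJ // trmx_mul trmxK (mulmx_tail (ctc _ ta)) mulmx1.
have Yal al : tgt Q al = a -> (c al)^T *m DY al *m idm _ _ = (p al)^T *m (iota_mx a X)^T.
  move=> ta; rewrite /dual_rep sink_reflection_eq // 3!trmx_mul !tr_idm !mulmxA.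
  rewrite (idmK _ (esym (sink_dim_src ta))) mul1mx -mulmxA idmK ?mulmx1 //.
  by have /eqP := tgt_reflect_op al; rewrite ta eqxx => /eqP/eqP /= ->.
have Jphi : J^T *m phi a DY = (iota_mx a X)^T.
  rewrite -[LHS]mul1mx -[RHS]mul1mx -(proj_sum Q n a K) !mulmx_suml.
  apply: eq_bigr => al /eqP ta; rewrite -!mulmxA; congr (_ *m _).
  rewrite -Yal // -!mulmxA [LHS]mulmxA -trmx_mul Jp // trmx_mul -mulmxA.
  by congr (_ *m _); rewrite proj_tr_phi //; apply/eqP; rewrite tgt_reflect_op ta.
have phiE : phi a DY = J *m (iota_mx a X)^T by rewrite -Jphi mulmxA JJt mul1mx.
have [|rho' [sigma' [ip' ir' sp' ex']]] := @split_exact_iota K Q0 Q1 (op P) _ a DY.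
  apply/row_fullP; exists (rho^T *m J^T).
  by rewrite -mulmxA Jphi -trmx_mul ir trmx1.
have E0 : (phi a DY)^T *m J *m phi a X = 0.
  by rewrite -[_ *m J]trmxK trmx_mul trmxK Jphi trmxK.
have tail' : (iota_mx a DY)^T *m rho'^T = 1%:M - sigma'^T *m (phi a DY)^T.
  by rewrite -!trmx_mul -[1%:M]trmx1 -ex' raddfD /= addrK.
have E : (iota_mx a DY)^T *m (rho'^T *m J *m phi a X) = J *m phi a X.
  by rewrite !mulmxA tail' !mulmxBl mul1mx !(mulmx_tail2 E0) mulmx0 subr0.
(* Each map lifts along a section of one cokernel and projects to the other: [rho'^T] is a section
   of the transpose of [iota_mx a DY], and [sigma] one of [phi a X]. *)
exists (rho'^T *m J *m phi a X), (sigma *m J^T *m (iota_mx a DY)^T); split.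
- have ex1 : phi a X *m sigma = 1%:M - rho *m iota_mx a X by rewrite -ex addrAC subrr add0r.
  have iJ0 : iota_mx a X *m J^T *m (iota_mx a DY)^T = 0.
    by rewrite -mulmxA -trmx_mul -[iota_mx a X]trmxK -trmx_mul -mulmxA -phiE ip' trmx0.
  rewrite !mulmxA (mulmx_tail ex1) mulmxBr mulmx1 !mulmxBl !mulmxA.
  rewrite (mulmx_tail2 iJ0) mulmx0 subr0 (mulmx_tail JJt) mulmx1.
  by rewrite -trmx_mul ir' trmx1.
- by rewrite -mulmxA E mulmxA (mulmx_tail JtJ) mulmx1.
- move=> al ta; rewrite -mulmxA E mulmxA -(mulmxA _ _ J) (pJ _ ta) mulmxA.
  have ctE : idm _ _ = (c al)^T by rewrite /c tr_idm.
  by rewrite ctE ctc // mul1mx proj_tr_phi.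
Qed.
End Identification.

(** * Morphisms to and from the simple at a sink *)

(* Unlike [eqVneq], leaves the occurrences of [x == y] in dependent types alone. *)
Lemma eq_or_neq (T : eqType) (x y : T) : x = y \/ x != y.
Proof. by case: eqVneq => [|_]; [left | right]. Qed.

Lemma row_image0 (R : nzRingType) p n (A : 'M[R]_(p, n)) : row_image A 0.
Proof. by exists 0; rewrite mul0mx. Qed.

Lemma row_image_lin (R : nzRingType) p n (A : 'M[R]_(p, n)) c u v :
  row_image A u -> row_image A v -> row_image A (c *: u + v).
Proof. by move=> [x ->] [y ->]; exists (c *: x + y); rewrite mulmxDl scalemxAl. Qed.

Lemma row_image_sum (R : nzRingType) p n (A : 'M[R]_(p, n)) (I : finType) (B : pred I)
    (u : I -> 'rV_n) :
  (forall i, B i -> row_image A (u i)) -> row_image A (\sum_(i | B i) u i).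
Proof.
move=> H; elim/big_ind: _ => [|x y Ax Ay|//]; first exact: row_image0.
by rewrite -[x]scale1r; apply: row_image_lin.
Qed.

Lemma row_image_mx1 (R : nzRingType) n : row_image (1%:M : 'M[R]_n) = setT.
Proof. by apply/seteqP; split=> // v _; exists v; rewrite mulmx1. Qed.

Lemma row_image_idm (R : nzRingType) m n (P : 'M[R]_n) (v : 'rV_m) : m = n ->
  row_image (idm m n *m P *m idm n m) v <-> row_image P (v *m idm m n).
Proof. by move=> e; subst m; rewrite !idm1 mul1mx !mulmx1. Qed.

Lemma map_row_image (R S : comNzRingType) (f : {rmorphism R -> S}) nu (Q0 : finType)
    (n : Q0 -> nat) (U : flag nu R n) k i (P : 'M[R]_(n i)) :
  U k i = row_image P -> (map_flag f U) k i = row_image (map_mx f P).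
Proof.
move=> UP; apply/seteqP; split=> v.
  move=> [m [c [u [Uu ->]]]]; apply: row_image_sum => l _.
  have := Uu l; rewrite UP => -[w ->]; rewrite map_mxM -[_ *: _]addr0.
  by apply: row_image_lin; [exists (map_mx f w) | exact: row_image0].
move=> [w ->]; exists (n i), (fun l => w 0 l), (fun l => row l P); split.
  by move=> l; rewrite UP; exists (delta_mx 0 l); rewrite -rowE.
by rewrite mulmx_sum_row; apply: eq_bigr => l _; rewrite map_row.
Qed.

Lemma map_phi (R S : nzRingType) (f : {rmorphism R -> S}) (Q0 Q1 : finType)
    (Q : quiver Q0 Q1) (n : Q0 -> nat) a (X : rep R Q n) :
  map_mx f (phi a X) = phi a (map_rep f X).
Proof.
rewrite !phi_sum [LHS](big_morph _ (@map_mxD _ _ f _ _) (map_mx0 f _ _)).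
by apply: eq_bigr => al _; rewrite !map_mxM map_proj map_idm.
Qed.

Section HomToSimple.
Variables (Q0 Q1 : finType) (Q : quiver Q0 Q1) (n : Q0 -> nat) (a : Q0).

Lemma block_sum_phi (R : nzRingType) (X : rep R Q n) (W : subfamily R n)
    (P : forall i, 'M[R]_(n i)) :
  (forall i, P i *m P i = P i) -> (forall i, W i = row_image (P i)) ->
  is_subrep X W -> block_sum Q a P *m phi a X *m P a = block_sum Q a P *m phi a X.
Proof.
move=> PP WP sub.
rewrite {1 2}/block_sum !mulmx_suml; apply: eq_bigr => al /eqP ta.
rewrite !(mulmx_tail (proj_tr_phi X ta)).
rewrite -[RHS]mulmxA -2!(mulmxA (in_proj _ _ _ _ _)); congr (_ *m _).
apply/row_matrixP => i; rewrite row_mul; apply/(row_imageP _ (PP _)); rewrite -WP.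
rewrite mulmxA row_mul; apply/(subfamily_idm _ ta).
by rewrite row_mul; apply: sub; rewrite WP; exists (delta_mx 0 i); rewrite rowE.
Qed.

(* If the image of the incoming arrows missed some of [W a], a linear form
   vanishing on it would give a nonzero morphism to the simple. *)
Lemma hom_sub_zero_surjective (L : fieldType) (X : rep L Q n) (W : subfamily L n)
    (P : forall i, 'M[L]_(n i)) :
  (forall i, P i *m P i = P i) -> (forall i, W i = row_image (P i)) ->
  hom_sub_zero X W (simple_rep L Q a) ->
  (P a <= block_sum Q a P *m phi a X)%MS.
Proof.
move=> PP WP hom; rewrite submxE; apply/eqP/matrixP => i j; rewrite [RHS]mxE.
set c := cokermx _.
(* [B m] reads off the entry [j]. Its width [m] is 1 at [a] and 0 elsewhere, so one formula defines
   [F] at every vertex. *)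
pose B m : 'M[L]_(_, m) := \matrix_(y, x) (y == j)%:R.
pose F l (u : 'rV[L]_(n l)) := u *m idm (n l) (n a) *m c *m B (l == a : nat).
have Pa : W a (row i (P a)) by rewrite WP; exists (delta_mx 0 i); rewrite rowE.
have H : F a (row i (P a)) = 0.
  apply: (hom F) => // [l b u v _ _|al u Wu].
    by rewrite /F !mulmxDl -!scalemxAl.
  rewrite /simple_rep mulmx0; case: (eq_or_neq (tgt Q al) a) => [ta|ta]; last first.
    by apply/rowP => -[x xlt]; exfalso; rewrite (negbTE ta) in xlt.
  have : u *m (in_proj L Q n a al)^T *m block_sum Q a P *m phi a X *m c = 0.
    by rewrite -!mulmxA [block_sum _ _ _ *m _]mulmxA mulmx_coker !mulmx0.
  move: Wu; rewrite WP => /(row_imageP _ (PP _)) uP.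
  rewrite (mulmx_tail (tr_proj_block_sum _ ta)) mulmxA uP.
  by rewrite (mulmx_tail (proj_tr_phi X ta)) mulmxA /F => ->; rewrite mul0mx.
have lt0 : (0 < (a == a : nat))%N by rewrite eqxx.
have vB m (v : 'rV_(n a)) x : (v *m B m) 0 x = v 0 j.
  rewrite mxE (bigD1 j) //= [B _ _ _]mxE eqxx mulr1 big1 ?addr0 // => y yj.
  by rewrite mxE (negbTE yj) mulr0.
have /rowP/(_ (Ordinal lt0)) := H.
by rewrite /F idm1 mulmx1 -row_mul vB !mxE.
Qed.

(** The arrows of the simple are zero, so a morphism to it kills the image of every arrow, and these
    images span [W a]. *)
Lemma hom_sub_zero_of_surjective (L : nzRingType) (X : rep L Q n) (W : subfamily L n)
    (P : forall i, 'M[L]_(n i)) :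
  (forall i, W i = row_image (P i)) -> is_subrep X W ->
  (forall y, W a y -> exists2 e, (forall al, tgt Q al = a ->
     W (src Q al) (e *m in_proj L Q n a al)) & y = e *m phi a X) ->
  hom_sub_zero X W (simple_rep L Q a).
Proof.
move=> WP sub surj F Flin Farr i u Wu.
case: (eq_or_neq i a) => [ia|ia]; last first.
  by apply/rowP => -[x xlt]; exfalso; rewrite (negbTE ia) in xlt.
subst i; have [e We ->] := surj u Wu.
have W0 l : W l 0 by rewrite WP; exact: row_image0.
have F0 l : F l 0 = 0.
  by have := Flin l (-1) 0 0 (W0 l) (W0 l); rewrite !scaleN1r !addNr.
rewrite phi_sum mulmx_sumr.
(* [F] is linear only on [W], so the induction over the sum has to carry membership. *)
pose good z := W a z /\ F a z = 0.
suff [] : good (\sum_(al | tgt Q al == a) e *m (in_proj L Q n a al *m X al *m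
    idm (n (tgt Q al)) (n a))) by [].
elim/big_ind: _ => [|x y [Wx Fx] [Wy Fy]|al /eqP ta].
- by split; rewrite ?F0.
- split; first by rewrite WP in Wx Wy *; rewrite -[x]scale1r; exact: row_image_lin.
  by rewrite -[x]scale1r Flin // Fx Fy scaler0 addr0.
- have Wal := We al ta; rewrite !mulmxA; split.
    by apply/(subfamily_idm _ ta); apply: sub.
  have Fidm k l (kl : k = l) v : F l (v *m idm (n k) (n l)) = F k v *m idm _ _.
    by subst l; rewrite !idm1 !mulmx1.
  by rewrite Fidm // Farr // /simple_rep mulmx0 mul0mx.
Qed.

End HomToSimple.

Section HomFromSimple.
Variables (K : fieldType) (Q0 Q1 : finType) (Q : quiver Q0 Q1) (n : Q0 -> nat).
Variables (a : Q0) (X : rep K Q n).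
Hypothesis sink_a : is_sink Q a.
Variables (L : nzRingType) (g : {rmorphism K -> L}).

Local Notation P := (reflect_quiver a Q).
Local Notation Y := (sink_reflection a X).
Local Notation iotaL := (map_mx g (iota_mx a X)).

Variables (V : subfamily L (sink_dim a X)) (PV : forall i, 'M[L]_(sink_dim a X i)).
Arguments V : clear implicits.
Hypothesis V_image : forall i, V i = row_image (PV i).

Let good w := forall al, tgt Q al = a ->
  V (src (op P) al) (w *m iotaL *m in_proj L Q n a al *m idm _ _).

(** A vector [w] at [a] whose images under all arrows leaving [a] lie in [V] defines a morphism from
    the simple to the quotient by [V]. *)
Lemma hom_quot_zero_injective :
  hom_quot_zero (simple_rep L P a) (map_rep g Y) V -> forall w, good w -> V a w.
Proof.
move=> hom w gw.
have V0 i : V i 0 by rewrite V_image; exact: row_image0.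
(* The sum of the entries of [u] is its only coordinate at [a] and the empty sum elsewhere. *)
pose G i (u : 'rV[L]_(nat_of_bool (i == a))) : 'rV[L]_(sink_dim a X i) :=
  (\sum_x u 0 x) *: (w *m idm (sink_dim a X a) (sink_dim a X i)).
have := hom G _ _ a (const_mx 1).
have -> : G a (const_mx 1) = w.
  rewrite /G idm1 mulmx1; under eq_bigr do rewrite mxE.
  by rewrite sumr_const card_ord eqxx scale1r.
apply=> [i c u v|al u].
  have -> : G i (c *: u + v) = c *: G i u + G i v; last by rewrite subrr.
  rewrite /G scalerA -scalerDl mulr_sumr -big_split /=; congr (_ *: _).
  by apply: eq_bigr => x _; rewrite !mxE.
have -> : G (tgt P al) (u *m simple_rep L P a al) = 0.
  by rewrite /G big1 ?scale0r // => x _; rewrite /simple_rep mulmx0 mxE.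
rewrite sub0r /G /map_rep -scalemxAl -scaleNr.
case: (eq_or_neq (tgt Q al) a) => [ta|ta]; last first.
  rewrite big1 ?oppr0 ?scale0r // => -[x xlt]; exfalso.
  move: xlt; have := tgt_reflect_op sink_a al; rewrite /= => ->.
  by rewrite (negbTE ta).
rewrite sink_reflection_eq // !map_mxM !map_idm map_proj !mulmxA.
have sPa : src P al = a by apply/eqP; have := tgt_reflect_op sink_a al; rewrite /= => ->; rewrite ta.
rewrite -(mulmxA w) idmK ?sPa // mulmx1.
have := gw al ta; rewrite V_image -[_ *: _]addr0 => gg.
by apply: row_image_lin; [exact: gg | exact: row_image0].
Qed.

Lemma hom_quot_zero_of_injective : (forall w, good w -> V a w) ->
  hom_quot_zero (simple_rep L P a) (map_rep g Y) V.
Proof.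
move=> inj G Glin Garr i u.
have V0 l : V l 0 by rewrite V_image; exact: row_image0.
have VN l x : V l (- x) <-> V l x.
  by rewrite V_image; split=> -[y E]; exists (- y); rewrite mulNmx -E ?opprK.
have VD l x y : V l x -> V l y -> V l (x + y).
  by rewrite V_image => Vx Vy; rewrite -[x]scale1r; exact: row_image_lin.
have G0 l : V l (G l 0).
  have := Glin l 1 0 0; rewrite !scale1r addr0 opprD addrA subrr sub0r.
  by move/VN.
case: (eq_or_neq i a) => [ia|ia]; last first.
  suff -> : u = 0 by [].
  by apply/rowP => -[x xlt]; exfalso; rewrite (negbTE ia) in xlt.
subst i; apply: inj => al ta.
have sPa : a = src P al.
  by apply/esym/eqP; have := tgt_reflect_op sink_a al; rewrite /= => ->; rewrite ta.
have key j (ja : j = src P al) (x : 'rV[L]_(nat_of_bool (j == a))) :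
    V (tgt P al) (G j x *m idm (sink_dim a X j) (sink_dim a X (src P al)) *m
      map_rep g Y al).
  subst j; rewrite idm1 mulmx1.
  have := Garr al x; rewrite /simple_rep mulmx0 => H.
  by apply/VN; rewrite -[- _](addKr (G (tgt P al) 0)); apply: VD => //; apply/VN.
have := key a sPa u; rewrite /map_rep sink_reflection_eq // !map_mxM !map_idm map_proj !mulmxA.
by rewrite -(mulmxA (G a u)) idmK ?mulmx1 // -sPa.
Qed.

End HomFromSimple.

(** * Corresponding flags *)

(** Idempotents with the same row image absorb each other, so they have equal row spaces on every
    fibre; the rank may be read off from any of them. *)
Lemma summand_rank (R : comNzRingType) n (W : set 'rV[R]_n) r (P : 'M[R]_n) :
  P *m P = P -> W = row_image P -> summand_of_rank W r ->
  forall (L : fieldType) (f : {rmorphism R -> L}), (\rank (map_mx f P))%:Z = r.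
Proof.
move=> PP -> [P' [PP' E rk]] L f; rewrite -(rk L f).
have [PP'P P'PP'] := row_image_eq PP PP' E.
congr (_%:Z); apply/eqmx_rank/andP; split.
  by rewrite -PP'P map_mxM submxMl.
by rewrite -P'PP' map_mxM submxMl.
Qed.

Lemma idm_idem (R : nzRingType) m n (A : 'M[R]_n) : m = n -> A *m A = A ->
  idm m n *m A *m idm n m *m (idm m n *m A *m idm n m) = idm m n *m A *m idm n m.
Proof. by move=> e; subst m; rewrite idm1 mul1mx mulmx1. Qed.

Lemma mxrank_idm (L : fieldType) m n (A : 'M[L]_n) : m = n ->
  \rank (idm m n *m A *m idm n m) = \rank A.
Proof. by move=> e; subst m; rewrite idm1 mul1mx mulmx1. Qed.

Lemma reflect_dim_neq (Q0 Q1 : finType) (Q : quiver Q0 Q1) a (d : Q0 -> int) i :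
  i != a -> reflect_dim Q a d i = d i.
Proof. by rewrite /reflect_dim /unit_dim => /negbTE ->; rewrite mulr0 subr0. Qed.

(** The diagonal parts of the symmetrised form contribute [d a] twice, and no arrow starts at [a].
    The result is the rank that [adapted_rank] forces on [V] at [a]. *)
Lemma reflect_dim_sink (Q0 Q1 : finType) (Q : quiver Q0 Q1) a (d : Q0 -> int) :
  is_sink Q a ->
  reflect_dim Q a d a = \sum_(al | tgt Q al == a) d (src Q al) - d a.
Proof.
move=> sink_a; rewrite /reflect_dim /sym_form /euler_form /unit_dim eqxx mulr1.
have E (F : Q0 -> int) : \sum_i F i * (i == a)%:Z = F a.
  by rewrite (bigD1 a) //= eqxx mulr1 big1 ?addr0 // => i /negbTE ->; rewrite mulr0.
rewrite E [X in _ + (X - _)](_ : _ = d a); last first.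
  by under eq_bigr do rewrite mulrC; rewrite E.
rewrite [X in _ + (_ - X)]big1 ?subr0; last first.
  by move=> al _; rewrite (negbTE (sink_a al)) mul0r.
rewrite [X in d a - X + _](_ : _ = \sum_(al | tgt Q al == a) d (src Q al)).
  by rewrite opprD opprB addrA addrCA subrr addr0 .
rewrite [RHS]big_mkcond; apply: eq_bigr => al _.
by case: eqP; rewrite ?mulr1 ?mulr0.
Qed.

Section Linked.
Variables (K : fieldType) (Q0 Q1 : finType) (Q : quiver Q0 Q1) (n : Q0 -> nat).
Variables (a : Q0) (X : rep K Q n) (nu : nat).
Hypothesis sink_a : is_sink Q a.

Local Notation P := (reflect_quiver a Q).
Local Notation Y := (sink_reflection a X).
Local Notation N := #|in_coord Q n a|.
Local Notation sd := (sink_dim a X).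

(** The correspondence of flags: common idempotents away from [a], an adapted triple at [a]. The
    matrices [iR] and [phiR] are parameters so that the relation also makes sense on a fibre over a
    field with no chosen [K]-algebra structure. *)
Definition linked (R : nzRingType) (iR : 'M[R]_(sd a, N)) (phiR : 'M[R]_(N, n a))
    (U : flag nu R n) (V : flag nu R sd) :=
  exists (PU : 'I_nu.+1 -> forall i, 'M[R]_(n i)) (PV : 'I_nu.+1 -> 'M[R]_(sd a)),
  [/\ forall k i, PU k i *m PU k i = PU k i,
      forall k i, U k i = row_image (PU k i),
      forall k i, i != a -> V k i = row_image (idm (sd i) (n i) *m PU k i *m idm _ _),
      forall k, V k a = row_image (PV k) &
      forall k, adapted iR phiR (block_sum Q a (PU k)) (PV k) (PU k a)].

Lemma linked_map (R S : comNzRingType) (f : {rmorphism R -> S}) iR phiR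
    (U : flag nu R n) (V : flag nu R sd) :
  linked iR phiR U V ->
  linked (map_mx f iR) (map_mx f phiR) (map_flag f U) (map_flag f V).
Proof.
move=> [PU [PV [PP UP VP VPa ad]]].
exists (fun k i => map_mx f (PU k i)), (fun k => map_mx f (PV k)); split.
- by move=> k i; rewrite -map_mxM PP.
- by move=> k i; apply: map_row_image.
- by move=> k i ia; rewrite (map_row_image f (VP k i ia)) !map_mxM !map_idm.
- by move=> k; apply: map_row_image.
- by move=> k; rewrite -map_block_sum; apply: adapted_map.
Qed.

Section Members.
Variables (R : nzRingType) (iR : 'M[R]_(sd a, N)) (phiR : 'M[R]_(N, n a)).
Variables (U : flag nu R n) (V : flag nu R sd).
Arguments U : clear implicits.
Arguments V : clear implicits.
Hypothesis linkUV : linked iR phiR U V.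

Lemma linked_neq k i v : i != a -> V k i v <-> U k i (v *m idm _ _).
Proof.
case: linkUV => PU [PV [PP UP VP VPa ad]] ia.
by rewrite VP // UP; apply: row_image_idm; rewrite sink_dim_neq.
Qed.

Lemma linked_neqr k i u : i != a -> U k i u <-> V k i (u *m idm _ _).
Proof.
move=> ia; rewrite linked_neq // -mulmxA idmK ?mulmx1 //.
by rewrite sink_dim_neq.
Qed.

Lemma linked_eq k v : V k a v <->
  forall al, tgt Q al = a -> U k (src Q al) (v *m iR *m in_proj R Q n a al).
Proof.
case: linkUV => PU [PV [PP UP VP VPa ad]].
rewrite VPa (adapted_sub v (ad k)) row_image_block_sum //.
by split=> H al ta; have := H al ta; rewrite UP.
Qed.

(** With [linked_neq] and [linked_eq], this shows that [U] and [V] determine each other, since the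
    sources of arrows into a sink differ from [a]. *)
Lemma linked_quot k y : U k a y <-> exists2 e,
  (forall al, tgt Q al = a -> U k (src Q al) (e *m in_proj R Q n a al)) &
  y = e *m phiR.
Proof.
case: linkUV => PU [PV [PP UP VP VPa ad]].
rewrite UP (adapted_quot y (ad k)).
by split=> -[e He yE]; exists e => //; move: He; rewrite row_image_block_sum // => H al ta;
  have := H al ta; rewrite UP.
Qed.

Lemma linked0 k i : U k i 0.
Proof. by case: linkUV => PU [PV [PP UP VP VPa ad]]; rewrite UP; exact: row_image0. Qed.

Lemma linked_image_source : exists PV : 'I_nu.+1 -> forall i, 'M[R]_(sd i), forall k i, V k i = row_image (PV k i).
Proof.
case: linkUV => PU [PV [PP UP VP VPa ad]].
exists (fun k i => if i == a then idm (sd i) (sd a) *m PV k *m idm _ _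
  else idm (sd i) (n i) *m PU k i *m idm _ _) => k i.
have [->|ia] := eq_or_neq i a; first by rewrite eqxx !idm1 mul1mx mulmx1.
by rewrite (negbTE ia) VP.
Qed.

End Members.

Section Transfer.
Variables (R : comNzRingType) (g : {rmorphism K -> R}).
Local Notation iR := (map_mx g (iota_mx a X)).
Local Notation phiR := (map_mx g (phi a X)).
Variables (U : flag nu R n) (V : flag nu R sd).
Arguments U : clear implicits.
Arguments V : clear implicits.
Hypothesis linkUV : linked iR phiR U V.
Variables (rho : 'M[K]_(N, sd a)) (sigma : 'M[K]_(n a, N)).
Hypothesis exact_X : split_exact (iota_mx a X) (phi a X) rho sigma.
Variable e : 'I_nu.+1 -> Q0 -> int.

Lemma linked_subrep_source k :
  is_subrep (map_rep g X) (U k) -> is_subrep (map_rep g Y) (V k).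
Proof.
move=> sub al u; rewrite /map_rep.
have [ta|ta] := eq_or_neq (tgt Q al) a.
  have sa := sink_a al.
  have sPa : src P al = a by apply/eqP; have := tgt_reflect_op sink_a al; rewrite /= => ->; rewrite ta.
  have tPa : tgt P al = src Q al := src_reflect_op_eq sink_a ta.
  move=> /(subfamily_idm (V k) sPa)/(linked_eq linkUV)/(_ al ta) H.
  rewrite sink_reflection_eq // !map_mxM !map_idm map_proj.
  apply/(linked_neq linkUV); first by rewrite tPa.
  rewrite !mulmxA -(mulmxA _ (idm _ _) (idm _ _)) idm_comp; last by rewrite sink_dim_src.
  by apply/(subfamily_idm (U k) (esym tPa)).
have sa := sink_a al.
have sPa : src P al = src Q al := tgt_reflect_op_neq sink_a ta.
have tPa : tgt P al = tgt Q al := src_reflect_op_neq sink_a ta.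
have sPn : src P al != a by rewrite sPa.
have tPn : tgt P al != a by rewrite tPa.
move=> /(linked_neq linkUV _ _ sPn)/(subfamily_idm (U k) sPa)/(sub al) H.
apply/(linked_neq linkUV _ _ tPn)/(subfamily_idm (U k) tPa).
rewrite sink_reflection_neq // !map_mxM !map_idm !mulmxA.
have et : n (tgt P al) = n (tgt Q al) by rewrite tPa.
rewrite (mulmx_tail (idm_compr _ _ (sink_dim_neq X tPn))).
rewrite (mulmx_tail (idmK _ (esym et))) mulmx1.
by move: H; rewrite (mulmx_tail (idm_comp _ _ (sink_dim_neq X sPn))).
Qed.

Lemma linked_subrep_sink k :
  is_subrep (map_rep g Y) (V k) -> is_subrep (map_rep g X) (U k).
Proof.
move=> sub al u Uu; have sa := sink_a al; rewrite /map_rep.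
have [ta|ta] := eq_or_neq (tgt Q al) a.
  apply/(subfamily_idm (U k) ta)/(linked_quot linkUV).
  (* The vector [u] placed in the summand of [al]; [phi] sends it to its image under the arrow. *)
  exists (u *m (in_proj R Q n a al)^T) => [be tb|]; last first.
    by rewrite map_phi (mulmx_tail (proj_tr_phi _ ta)) mulmxA.
  have [<-|ab] := eq_or_neq al be; first by rewrite -mulmxA proj_tr_proj // mulmx1.
  by rewrite -mulmxA proj_tr_proj0 // mulmx0; exact: (linked0 linkUV).
have sPa : src P al = src Q al := tgt_reflect_op_neq sink_a ta.
have tPa : tgt P al = tgt Q al := src_reflect_op_neq sink_a ta.
have sPn : src P al != a by rewrite sPa.
have tPn : tgt P al != a by rewrite tPa.
move: Uu => /(subfamily_idm (U k) (esym sPa))/(linked_neqr linkUV _ _ sPn)/(sub al).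
move=> /(linked_neq linkUV _ _ tPn)/(subfamily_idm (U k) tPa).
rewrite /map_rep sink_reflection_neq // !map_mxM !map_idm !mulmxA.
have es : n (src Q al) = n (src P al) by rewrite sPa.
have et : n (tgt P al) = n (tgt Q al) by rewrite tPa.
rewrite (mulmx_tail (idm_compr _ _ (sink_dim_neq X tPn))).
rewrite (mulmx_tail (idmK _ (esym et))) mulmx1.
rewrite (mulmx_tail (idm_comp _ _ es)) (mulmx_tail (idmK _ _)) ?mulmx1 //.
by rewrite sink_dim_neq.
Qed.

Lemma linked_mono_source : 
  (forall (k l : 'I_nu.+1) i, (k <= l)%N -> U k i `<=` U l i) ->
  (forall (k l : 'I_nu.+1) i, (k <= l)%N -> V k i `<=` V l i).
Proof.
move=> mono k l i kl v; have [ia|ia] := eq_or_neq i a.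
  subst i.
  by move=> /(linked_eq linkUV) H; apply/(linked_eq linkUV) => al ta; apply: mono (H al ta).
by move=> /(linked_neq linkUV _ _ ia) H; apply/(linked_neq linkUV _ _ ia); apply: mono H.
Qed.

Lemma linked_mono_sink : 
  (forall (k l : 'I_nu.+1) i, (k <= l)%N -> V k i `<=` V l i) ->
  (forall (k l : 'I_nu.+1) i, (k <= l)%N -> U k i `<=` U l i).
Proof.
move=> mono k l i kl v.
have mono' j u : j != a -> U k j u -> U l j u.
  move=> ja /(linked_neqr linkUV _ _ ja) H.
  by apply/(linked_neqr linkUV _ _ ja); apply: mono H.
have [ia|ia] := eq_or_neq i a; last exact: mono'.
subst i.
move=> /(linked_quot linkUV)[x Hx ->]; apply/(linked_quot linkUV); exists x => // al ta.
by apply: mono' (Hx al ta).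
Qed.

Lemma linked_max_source :
  (forall i, U ord_max i = setT) -> (forall i, V ord_max i = setT).
Proof.
move=> max i; apply/seteqP; split=> // v _; have [ia|ia] := eq_or_neq i a; last first.
  by apply/(linked_neq linkUV _ _ ia); rewrite max.
by subst i; apply/(linked_eq linkUV) => al ta; rewrite max.
Qed.

Lemma linked_max_sink :
  (forall i, V ord_max i = setT) -> (forall i, U ord_max i = setT).
Proof.
move=> max.
have max' j u : j != a -> U ord_max j u.
  by move=> ja; apply/(linked_neqr linkUV _ _ ja); rewrite max.
move=> i; apply/seteqP; split=> // v _; have [ia|ia] := eq_or_neq i a; last exact: max'.
subst i; apply/(linked_quot linkUV); exists (v *m map_mx g sigma).
  by move=> al ta; apply: max'; exact: sink_a.
by case: exact_X => _ _ sp _; rewrite -mulmxA -map_mxM sp map_mx1 mulmx1.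
Qed.

(** On each fibre the rank at [a] is the rank of [E_U] minus that of [U_a], which is the reflected
    dimension. *)
Lemma linked_summand_source :
  (forall k i, summand_of_rank (U k i) (e k i)) ->
  (forall k i, summand_of_rank (V k i) (reflect_dim Q a (e k) i)).
Proof.
move=> sumU k i; have [PU [PV [PP UP VP VPa ad]]] := linkUV.
have [ia|ia] := eq_or_neq i a; last first.
  exists (idm (sd i) (n i) *m PU k i *m idm _ _); split.
  - exact: idm_idem (sink_dim_neq X ia) (PP k i).
  - exact: VP.
  - move=> L f; rewrite !map_mxM !map_idm mxrank_idm ?sink_dim_neq // reflect_dim_neq //.
    exact: (summand_rank (PP k i) (UP k i) (sumU k i)).
subst i; have [[_ PVV _] _ _ _ _] := ad k.
exists (PV k); split=> // L f; rewrite reflect_dim_sink //.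
have /(adapted_rank (split_exact_map f (split_exact_map g exact_X))) := adapted_map f (ad k).
rewrite map_block_sum rank_block_sum => [H|i]; last by rewrite -map_mxM PP.
have rk i := summand_rank (PP k i) (UP k i) (sumU k i) f.
rewrite -(rk a); under eq_bigr do rewrite -rk.
by rewrite -(big_morph Posz PoszD (erefl (0 : int))) H PoszD addrK.
Qed.

Lemma linked_summand_sink :
  (forall k i, summand_of_rank (V k i) (reflect_dim Q a (e k) i)) ->
  (forall k i, summand_of_rank (U k i) (e k i)).
Proof.
move=> sumV k i; have [PU [PV [PP UP VP VPa ad]]] := linkUV.
have rk j (L : fieldType) (f : {rmorphism R -> L}) : j != a ->
    (\rank (map_mx f (PU k j)))%:Z = e k j.
  move=> ja; rewrite -(reflect_dim_neq Q (e k) ja).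
  have PP' := idm_idem (sink_dim_neq X ja) (PP k j).
  have := summand_rank PP' (VP k j ja) (sumV k j) f.
  by rewrite !map_mxM !map_idm mxrank_idm // sink_dim_neq.
exists (PU k i); split=> // L f.
have [ia|ia] := eq_or_neq i a; last exact: rk.
subst i; have [[_ PVV _] _ _ _ _] := ad k.
have := summand_rank PVV (VPa k) (sumV k a) f; rewrite reflect_dim_sink //.
have /(adapted_rank (split_exact_map f (split_exact_map g exact_X))) := adapted_map f (ad k).
rewrite map_block_sum rank_block_sum => [H|i]; last by rewrite -map_mxM PP.
under eq_bigr => al _ do rewrite -(rk _ L f (sink_a al)).
rewrite -(big_morph Posz PoszD (erefl (0 : int))) H PoszD => /eqP.
by rewrite eq_sym subr_eq => /eqP/addrI.
Qed.

Lemma linked_is_flag_source :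
  is_flag (map_rep g X) e U -> is_flag (map_rep g Y) (fun k => reflect_dim Q a (e k)) V.
Proof.
case=> s1 s2 s3 s4; split.
- exact: linked_summand_source.
- by move=> k; exact: linked_subrep_source.
- exact: linked_mono_source.
- exact: linked_max_source.
Qed.

Lemma linked_is_flag_sink :
  is_flag (map_rep g Y) (fun k => reflect_dim Q a (e k)) V -> is_flag (map_rep g X) e U.
Proof.
case=> s1 s2 s3 s4; split.
- exact: linked_summand_sink.
- by move=> k; exact: linked_subrep_sink.
- exact: linked_mono_sink.
- exact: linked_max_sink.
Qed.

End Transfer.
End Linked.

(** * Existence of the corresponding flag *)

Lemma map_rep_comp (R S T : nzRingType) (f : S -> T) (g : R -> S) (Q0 Q1 : finType)
    (Q : quiver Q0 Q1) (n : Q0 -> nat) (X : rep R Q n) :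
  map_rep f (map_rep g X) = map_rep (f \o g) X.
Proof. by apply: functional_extensionality_dep => al; rewrite /map_rep map_mx_comp. Qed.

Lemma map_flag_subrep (R S : nzRingType) (f : {rmorphism R -> S}) (Q0 Q1 : finType)
    (Q : quiver Q0 Q1) (n : Q0 -> nat) (X : rep R Q n) nu (U : flag nu R n) k :
  is_subrep X (U k) -> is_subrep (map_rep f X) (map_flag f U k).
Proof.
move=> sub al _ [m [c [u [Uu ->]]]]; exists m, c, (fun l => u l *m X al); split.
  by move=> l; apply: sub.
by rewrite mulmx_suml; apply: eq_bigr => l _; rewrite -scalemxAl map_mxM.
Qed.

Section Points.
Variables (K : fieldType) (Q0 Q1 : finType) (Q : quiver Q0 Q1) (n : Q0 -> nat).
Variables (a : Q0) (X : rep K Q n) (nu : nat).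
Hypothesis sink_a : is_sink Q a.

Local Notation P := (reflect_quiver a Q).
Local Notation Y := (sink_reflection a X).
Local Notation N := #|in_coord Q n a|.
Local Notation sd := (sink_dim a X).

Lemma sink_reflection_subrep (R : nzRingType) (g : {rmorphism K -> R})
    (W : subfamily R sd) w al :
  is_subrep (map_rep g Y) W -> W a w -> tgt Q al = a ->
  W (src Q al) (w *m map_mx g (iota_mx a X) *m in_proj R Q n a al *m idm _ _).
Proof.
move=> sub Ww ta.
have sP : src P al = a by apply/eqP; have := tgt_reflect_op sink_a al; rewrite /= => ->; rewrite ta.
have tP : tgt P al = src Q al := src_reflect_op_eq sink_a ta.
have := sub al _ ((subfamily_idm W (esym sP) w).2 Ww).
rewrite /map_rep sink_reflection_eq // !map_mxM !map_idm map_proj !mulmxA.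
rewrite (mulmx_tail (idmK _ _)) ?sP // mulmx1 => /(subfamily_idm W tP).
by rewrite (mulmx_tail (idm_comp _ _ _)) // sink_dim_src.
Qed.

Section OpenConditions.
Variables (L : nzRingType) (g : {rmorphism K -> L}).
Variables (U : flag nu L n) (V : flag nu L sd).
Hypothesis linkUV : linked (map_mx g (iota_mx a X)) (map_mx g (phi a X)) U V.

Lemma linked_hom_quot_zero k : hom_quot_zero (simple_rep L P a) (map_rep g Y) (V k).
Proof.
have [PV VE] := linked_image_source linkUV.
apply: (hom_quot_zero_of_injective sink_a (PV := PV k)) => [//|w gw].
apply/(linked_eq linkUV) => al ta.
have sP : src (op P) al = src Q al := src_reflect_op_eq sink_a ta.
have sa : src (op P) al != a by rewrite sP; exact: sink_a.
have := gw al ta; move=> /(linked_neq linkUV _ _ sa)/(subfamily_idm (U k) sP).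
have sds : sd (src (op P) al) = n (src (op P) al) by rewrite sink_dim_neq.
have es : n (src Q al) = sd (src (op P) al) by rewrite sds sP.
rewrite (mulmx_tail (idm_comp _ _ es)) (mulmx_tail (idmK _ _)) ?mulmx1 //.
by rewrite sP.
Qed.

Lemma linked_hom_sub_zero k : is_subrep (map_rep g X) (U k) ->
  hom_sub_zero (map_rep g X) (U k) (simple_rep L Q a).
Proof.
move=> sub; have [PU [PV [PP UP VP VPa ad]]] := linkUV.
apply: (hom_sub_zero_of_surjective (UP k) sub) => y.
by rewrite (linked_quot linkUV) map_phi.
Qed.

End OpenConditions.

Variables (rho : 'M[K]_(N, sd a)) (sigma : 'M[K]_(n a, N)).
Hypothesis exact_X : split_exact (iota_mx a X) (phi a X) rho sigma.
Variable e : 'I_nu.+1 -> Q0 -> int.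

Lemma linked_of_sink (R : comNzRingType) (g : {rmorphism K -> R}) (U : flag nu R n) :
  is_flag (map_rep g X) e U ->
  (forall (L : fieldType) (f : {rmorphism R -> L}) k,
     hom_sub_zero (map_rep f (map_rep g X)) (map_flag f U k) (simple_rep L Q a)) ->
  exists V, linked (map_mx g (iota_mx a X)) (map_mx g (phi a X)) U V.
Proof.
move=> [summ sub _ _] hom.
pose PU k i := projT1 (cid (summ k i)).
have PP k i : PU k i *m PU k i = PU k i by rewrite /PU; case: cid => ? [].
have UP k i : U k i = row_image (PU k i) by rewrite /PU; case: cid => ? [].
have ad k : exists PV,
    adapted (map_mx g (iota_mx a X)) (map_mx g (phi a X)) (block_sum Q a (PU k)) PV (PU k a).
  apply: (fibrewise_kernel_summand (split_exact_map g exact_X)) => //.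
  - exact: block_sum_idem.
  - by rewrite map_phi; apply: (block_sum_phi a (PP k) (UP k)).
  - move=> L f; rewrite map_block_sum !map_phi.
    apply: (hom_sub_zero_surjective _ _ (hom L f k)) => i.
      by rewrite -map_mxM PP.
    exact: map_row_image.
pose PV k := projT1 (cid (ad k)).
exists (fun k i => row_image (if i == a then idm (sd i) (sd a) *m PV k *m idm _ _
  else idm (sd i) (n i) *m PU k i *m idm _ _)).
exists PU, PV; split=> // k.
- by move=> i ia; rewrite (negbTE ia).
- by rewrite eqxx !idm1 mul1mx mulmx1.
- by rewrite /PV; case: cid.
Qed.

Lemma linked_of_source (R : comNzRingType) (g : {rmorphism K -> R}) (V : flag nu R sd) :
  is_flag (map_rep g Y) (fun k => reflect_dim Q a (e k)) V ->
  (forall (L : fieldType) (f : {rmorphism R -> L}) k,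
     hom_quot_zero (simple_rep L P a) (map_rep f (map_rep g Y)) (map_flag f V k)) ->
  exists U, linked (map_mx g (iota_mx a X)) (map_mx g (phi a X)) U V.
Proof.
move=> [summ sub _ _] hom.
pose PV k i := projT1 (cid (summ k i)).
have PP k i : PV k i *m PV k i = PV k i by rewrite /PV; case: cid => ? [].
have VP k i : V k i = row_image (PV k i) by rewrite /PV; case: cid => ? [].
(* The value at [a] is a placeholder: [block_sum] looks only at sources of arrows into [a]. *)
pose P0 k i := if i == a then 1%:M else idm (n i) (sd i) *m PV k i *m idm _ _.
have P0P k i : P0 k i *m P0 k i = P0 k i.
  rewrite /P0; case: eqVneq => ia; first by rewrite mulmx1.
  by rewrite idm_idem // sink_dim_neq.
have P0E k i (u : 'rV_(n i)) : i != a -> row_image (P0 k i) u <-> V k i (u *m idm _ _).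
  by move=> ia; rewrite /P0 (negbTE ia) VP row_image_idm // sink_dim_neq.
have ad k : exists PU,
    adapted (map_mx g (iota_mx a X)) (map_mx g (phi a X)) (block_sum Q a (P0 k)) (PV k a) PU.
  apply: (fibrewise_quotient_summand (split_exact_map g exact_X)) => //.
  - exact: block_sum_idem.
  - apply/row_matrixP => i; rewrite row_mul; apply/row_imageP; first exact: block_sum_idem.
    apply/row_image_block_sum => // al ta; apply/P0E; first exact: sink_a.
    rewrite -!row_mul !row_mul; apply: (sink_reflection_subrep (sub k)) => //.
    by rewrite VP; exists (delta_mx 0 i); rewrite rowE.
  - move=> L f w; rewrite map_block_sum -map_mx_comp => Hw.
    rewrite -(map_row_image f (VP k a)).
    apply: (@hom_quot_zero_injective _ _ _ _ _ a X sink_a _ (f \o g) (map_flag f V k)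
      (fun i => map_mx f (PV k i))) => [i||al ta].
    + exact: map_row_image.
    + by have := hom L f k; rewrite map_rep_comp.
    have sP : src (op P) al = src Q al := src_reflect_op_eq sink_a ta.
    have PPf i : map_mx f (P0 k i) *m map_mx f (P0 k i) = map_mx f (P0 k i).
      by rewrite -map_mxM P0P.
    move: Hw => /(row_image_block_sum _ PPf)/(_ al ta).
    rewrite /P0 (negbTE (sink_a al)) !map_mxM !map_idm.
    move=> /(row_image_idm _ _ (esym (sink_dim_neq _ (sink_a al)))).
    rewrite -(map_row_image f (VP k (src Q al))) => H.
    apply/(subfamily_idm (map_flag f V k) sP); rewrite (mulmx_tail (idm_comp _ _ _)) //.
    by rewrite sink_dim_src.
pose PU k := projT1 (cid (ad k)).
(* The placeholder at [a] is replaced by the idempotent just found, leaving [block_sum]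
   unchanged. *)
pose P1 k i := if i == a then idm (n i) (n a) *m PU k *m idm _ _ else P0 k i.
have P1a k : P1 k a = PU k by rewrite /P1 eqxx !idm1 mul1mx mulmx1.
have P1neq k i : i != a -> P1 k i = P0 k i by rewrite /P1 => /negbTE ->.
have blockE k : block_sum Q a (P1 k) = block_sum Q a (P0 k).
  by apply: eq_bigr => al _; rewrite P1neq //; exact: sink_a.
have adPU k : adapted (map_mx g (iota_mx a X)) (map_mx g (phi a X))
    (block_sum Q a (P1 k)) (PV k a) (P1 k a).
  by rewrite blockE P1a /PU; case: cid.
exists (fun k i => row_image (P1 k i)).
exists P1, (fun k => PV k a); split=> //.
- move=> k i; have [->|ia] := eq_or_neq i a; last by rewrite P1neq.
  by have [[]] := adPU k.
- move=> k i ia; rewrite P1neq // /P0 (negbTE ia) VP; congr row_image.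
  rewrite !mulmxA idmK ?sink_dim_neq // mul1mx.
  by rewrite (mulmx_tail (idmK _ _)) ?mulmx1 // sink_dim_neq.
Qed.

End Points.

(** * The double reflection *)

Lemma row_image_mulmx0 (R : nzRingType) p m (A : 'M[R]_(p, m)) (z : 'cV_m) :
  (forall w, row_image A w -> w *m z = 0) <-> A *m z = 0.
Proof.
split=> [H|Az w [x ->]]; last by rewrite -mulmxA Az mulmx0.
apply/row_matrixP => i; rewrite row_mul row0; apply: H.
by exists (delta_mx 0 i); rewrite rowE.
Qed.

Section Inverse.
Variables (K : fieldType) (Q0 Q1 : finType) (Q : quiver Q0 Q1) (n : Q0 -> nat).
Variables (a : Q0) (X : rep K Q n).
Hypothesis sink_a : is_sink Q a.

Local Notation P := (reflect_quiver a Q).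
Local Notation Y := (sink_reflection a X).
Local Notation DY := (dual_rep (sink_reflection a X)).
Local Notation sd := (sink_dim a X).
Local Notation sd' := (sink_dim a (dual_rep (sink_reflection a X))).

Variables (theta_a : 'M[K]_(sd' a, n a)) (zeta_a : 'M[K]_(n a, sd' a)).
Hypothesis theta_zeta : theta_a *m zeta_a = 1%:M.
Hypothesis zeta_theta : zeta_a *m theta_a = 1%:M.
Hypothesis theta_arrow : forall al, tgt Q al = a ->
  idm (n (src Q al)) (sd (src (op P) al)) *m
    (in_proj K (op P) sd a al)^T *m (iota_mx a DY)^T *m theta_a =
  X al *m idm (n (tgt Q al)) (n a).

Definition glue_at (A : 'M[K]_(sd' a, n a)) i : 'M[K]_(sd' i, n i) :=
  if i == a then idm (sd' i) (sd' a) *m A *m idm (n a) (n i) else idm _ _.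

Lemma glue_at_neq A i : i != a -> glue_at A i = idm _ _.
Proof. by rewrite /glue_at => /negbTE ->. Qed.

Lemma glue_at_eq A : glue_at A a = A.
Proof. by rewrite /glue_at eqxx !idm1 mul1mx mulmx1. Qed.

Lemma double_dim_neq i : i != a -> sd' i = n i.
Proof. by move=> ia; rewrite !sink_dim_neq. Qed.

Local Notation P' := (op (reflect_quiver a (op P))).

Lemma double_reflection al : src P' al = src Q al /\ tgt P' al = tgt Q al.
Proof.
have sa := negbTE (sink_a al).
have at_op : at_vertex (op P) a al = at_vertex Q a al.
  by rewrite /at_vertex /= /at_vertex sa /=; case E: (tgt Q al == a); rewrite ?E ?sa.
rewrite /= at_op /at_vertex sa /=.
by case: (tgt Q al == a).
Qed.

Lemma glue_at_idm A i : a = i ->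
  idm (sd' a) (sd' i) *m glue_at A i = A *m idm (n a) (n i).
Proof. by move=> ai; subst i; rewrite glue_at_eq !idm1 mul1mx mulmx1. Qed.

Lemma source_reflection_eq al : tgt Q al = a ->
  source_reflection a Y al =
  idm _ _ *m (in_proj K (op P) sd a al)^T *m (iota_mx a DY)^T *m idm (sd' a) _.
Proof.
move=> ta; change (source_reflection a Y al) with (sink_reflection a DY al)^T.
have tPa : tgt (op P) al = a by apply/eqP; rewrite (tgt_reflect_op sink_a) ta.
have sP : src (op P) al != a by rewrite (src_reflect_op_eq sink_a ta); exact: sink_a.
by rewrite sink_reflection_eq // 3!trmx_mul !tr_idm !mulmxA.
Qed.

Lemma source_reflection_neq al : tgt Q al != a ->
  source_reflection a Y al = idm _ _ *m X al *m idm _ _.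
Proof.
move=> ta; change (source_reflection a Y al) with (sink_reflection a DY al)^T.
have sP : src (op P) al = tgt Q al := src_reflect_op_neq sink_a ta.
have tP : tgt (op P) al = src Q al := tgt_reflect_op_neq sink_a ta.
rewrite sink_reflection_neq; last first.
- by rewrite sP.
- by rewrite tP; exact: sink_a.
rewrite /dual_rep sink_reflection_neq ?sink_a //.
rewrite 2!trmx_mul !tr_idm trmxK !mulmxA.
rewrite idm_compr; last by rewrite sink_dim_neq -?tP // tP; exact: sink_a.
rewrite (mulmx_tail (idm_comp _ _ _)) //.
by rewrite sink_dim_neq -?sP // sP.
Qed.

Lemma glue_at_identification :
  is_identification a (source_reflection a Y) X (glue_at theta_a).
Proof.
split.
- exact: double_reflection.
- move=> al v w /Tagged_idm[es wE]; apply/Tagged_idm.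
  have [_ et] := double_reflection al; split; first exact: et.
  have sa := sink_a al; have sPn : src P' al != a by rewrite es.
  have dsP : sd' (src P' al) = n (src Q al) by rewrite double_dim_neq // es.
  have nsP : n (src P' al) = n (src Q al) by rewrite es.
  rewrite wE glue_at_neq // (mulmx_tail (idm_compr _ _ nsP)).
  have [ta|ta] := eq_or_neq (tgt Q al) a.
    have tPa : a = tgt P' al by rewrite et.
    have nt : n (tgt P' al) = n (tgt Q al) by rewrite et.
    rewrite source_reflection_eq // -(@idm_comp _ _ _ (sd (src (op P) al)) dsP) !mulmxA.
    rewrite (mulmx_tail (glue_at_idm _ tPa)).
    transitivity (v *m idm (sd' (src P' al)) (n (src Q al)) *m
      (idm (n (src Q al)) (sd (src (op P) al)) *m (in_proj K (op P) sd a al)^T *m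
        (iota_mx a DY)^T *m theta_a) *m
      idm (n a) (n (tgt P' al)) *m idm (n (tgt P' al)) (n (tgt Q al))).
      rewrite theta_arrow // (mulmx_tail (idm_compr _ _ nt)) !mulmxA.
      have nta : n (tgt Q al) = n a by rewrite ta.
      by rewrite (mulmx_tail (idmK _ nta)) mulmx1.
    by rewrite !mulmxA.
  have tPn : tgt P' al != a by rewrite et.
  have nt : n (tgt Q al) = sd' (tgt P' al) by rewrite double_dim_neq // et.
  rewrite source_reflection_neq // glue_at_neq // !mulmxA.
  rewrite (mulmx_tail (idm_comp _ _ (double_dim_neq tPn))).
  by rewrite (mulmx_tail (idm_comp _ _ nt)) ?idm1 ?mulmx1.
- move=> i; have [->|ia] := eq_or_neq i a.
    by exists zeta_a; rewrite glue_at_eq.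
  exists (idm _ _); rewrite glue_at_neq //.
  by have ed := double_dim_neq ia; split; rewrite idmK.
- move=> i ia; split; first exact: double_dim_neq.
  by move=> x y; rewrite glue_at_neq // mxE.
Qed.

Section SourceFlag.
Variables (nu : nat) (R : comAlgType K).
Variables (U : flag nu R n) (V : flag nu R sd).
Arguments U : clear implicits.
Arguments V : clear implicits.
Hypothesis linkUV :
  linked (map_mx (in_alg R) (iota_mx a X)) (map_mx (in_alg R) (phi a X)) U V.

(** The source flag is an outer annihilator. When the inner sink flag is itself the annihilator of
    the image of [D], in coordinates changed by [B'], biorthogonality returns that image. *)
Lemma source_flag_orthogonal k i m (B : 'M[R]_(sd' i, m)) (B' : 'M[R]_(m, sd' i)) (D : 'M[R]_m) x :
  D *m D = D -> B *m B' = 1%:M -> B' *m B = 1%:M ->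
  (forall u, (sink_flag (X := DY) (a := a) (dual_flag V)) (rev_ord k) i u <->
     D *m (B' *m u^T) = 0) ->
  (source_flag (Y := Y) (a := a) V) k i x <-> row_image D (x *m B).
Proof.
move=> DD BB' B'B H; rewrite -(orthogonal_orthogonal _ DD); split=> Hx.
  move=> z Dz; have /Hx : (sink_flag (X := DY) (a := a) (dual_flag V)) (rev_ord k) i (B *m z)^T.
    by apply/H; rewrite trmxK (mulmxA B') B'B mul1mx.
  by rewrite -trmx_mul mulmxA => /(congr1 trmx); rewrite trmxK trmx0.
move=> u /H /Hx; rewrite mulmxA (mulmx_tail BB') mulmx1 => /(congr1 trmx).
by rewrite trmx_mul trmxK trmx0.
Qed.

(** At [a], a functional belongs to the reflected dual flag exactly when, moved along [zeta_a], it
    annihilates the image of [E_V] under [phi]; by [linked_quot] that image is [U_a]. *)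
Lemma transport_source_flag :
  transport_flag (fun i => map_mx (in_alg R) (glue_at theta_a i))
    (source_flag (Y := Y) (a := a) V) = U.
Proof.
have [PU [PV [PP UP VP VPa ad]]] := linkUV.
apply: functional_extensionality_dep => k; apply: functional_extensionality_dep => i.
have key (theta zeta : 'M[R]_(_, _)) :
    theta *m zeta = 1%:M -> zeta *m theta = 1%:M ->
    (forall u, (sink_flag (X := DY) (a := a) (dual_flag V)) (rev_ord k) i u <->
       PU k i *m (zeta *m u^T) = 0) ->
  [set u *m theta | u in (source_flag (Y := Y) (a := a) V) k i] = U k i.
  move=> tz zt H; rewrite UP; apply/seteqP; split=> [_ [x Hx <-]|y Hy].
    exact: (source_flag_orthogonal x (PP k i) tz zt H).1 Hx.
  exists (y *m zeta); last by rewrite (mulmx_tail zt) mulmx1.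
  by apply/(source_flag_orthogonal _ (PP k i) tz zt H); rewrite (mulmx_tail zt) mulmx1.
have [ia|ia] := eq_or_neq i a; last first.
  have ed := double_dim_neq ia.
  rewrite /transport_flag glue_at_neq // map_idm.
  apply: (key _ (idm _ _)); rewrite ?idmK // => u.
  rewrite sink_flag_neq // /dual_flag /= rev_ordK trmx_mul tr_idm -row_image_mulmx0 -UP.
  have esd : n i = sd i by rewrite sink_dim_neq.
  split=> H w Hw.
    have := H _ ((linked_neqr linkUV _ _ ia).1 Hw).
    by rewrite !mulmxA (mulmx_tail (idm_comp _ _ esd)).
  have := H _ ((linked_neq linkUV _ _ ia).1 Hw).
  by rewrite !mulmxA (mulmx_tail (idm_comp _ _ (esym esd))).
subst i; rewrite /transport_flag glue_at_eq.
apply: (key _ (map_mx (in_alg R) zeta_a)); rewrite -?map_mxM ?theta_zeta ?zeta_theta ?map_mx1 //.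
move=> u; rewrite sink_flag_eq -row_image_mulmx0 -UP.
pose c := map_mx (in_alg R).
(* The transpose of [theta_arrow]: pairing [v] with the component of [u] at [al] is pairing the
   image of [v] under the arrow with the moved functional. *)
have arrow al v : tgt Q al = a ->
    v *m idm (n (src Q al)) (sd (src (op P) al)) *m
      (u *m c _ _ (iota_mx a DY) *m in_proj R (op P) sd a al)^T =
    v *m (in_proj R Q n a al)^T *m c _ _ (phi a X) *m (c _ _ zeta_a *m u^T).
  move=> ta; have := congr1 (c _ _) (theta_arrow ta).
  rewrite /c !map_mxM !map_idm -!map_trmx map_proj => ar.
  have {}ar : idm (n (src Q al)) (sd (src (op P) al)) *m (in_proj R (op P) sd a al)^T *m
      (map_mx (in_alg R) (iota_mx a DY))^T =
      (in_proj R Q n a al)^T *m map_mx (in_alg R) (phi a X) *m map_mx (in_alg R) zeta_a.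
    rewrite map_phi proj_tr_phi // -ar -[RHS]mulmxA -map_mxM theta_zeta map_mx1.
    by rewrite mulmx1.
  by rewrite 2!trmx_mul !mulmxA -(mulmxA v) -(mulmxA v _ (_^T)) ar !mulmxA.
have dims al (ta : tgt Q al = a) : [/\ src (op P) al = src Q al, src (op P) al != a,
    n (src Q al) = sd (src (op P) al) & n (src Q al) = n (src (op P) al)].
  have sP : src (op P) al = src Q al := src_reflect_op_eq sink_a ta.
  by rewrite sink_dim_src // sP; split=> //; exact: sink_a.
split=> [H w|H al].
  move=> /(linked_quot linkUV)[y Hy ->].
  rewrite (row_proj_sum y) !mulmx_suml big1 // => al /eqP ta.
  have [sP sPn esd en] := dims al ta.
  rewrite -arrow //; have tPa : tgt (op P) al = a by apply/eqP; rewrite (tgt_reflect_op sink_a) ta.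
  have := H al tPa; rewrite /dual_flag /= rev_ordK; apply.
  have := (subfamily_idm (U k) (esym sP) _).2 (Hy al ta).
  move=> /(linked_neqr linkUV _ _ sPn).
  by rewrite (mulmx_tail (idm_comp _ _ en)).
move=> /eqP; rewrite (tgt_reflect_op sink_a) => /eqP ta; rewrite /dual_flag /= rev_ordK => v Vv.
have [sP sPn esd en] := dims al ta.
have Uv := (subfamily_idm (U k) sP _).2 ((linked_neq linkUV _ _ sPn).1 Vv).
rewrite (mulmx_tail (idm_compr _ _ (esym en))) in Uv.
have := arrow _ al _ ta; move=> /(_ _ (v *m idm _ _)).
rewrite (mulmx_tail (idmK _ (esym esd))) mulmx1 => ->.
apply: H; apply/(linked_quot linkUV); exists (v *m idm _ _ *m (in_proj R Q n a al)^T) => //.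
move=> be tb; have [<-|ab] := eq_or_neq al be.
  by rewrite (mulmx_tail (proj_tr_proj _ _ ta)) mulmx1.
by rewrite (mulmx_tail (proj_tr_proj0 _ _ _ _ ab)) mulmx0; exact: (linked0 linkUV).
Qed.

End SourceFlag.
End Inverse.

(** * The isomorphism *)

Lemma hom_sub_zero_row_full (K : fieldType) (Q0 Q1 : finType) (Q : quiver Q0 Q1)
    (n : Q0 -> nat) (a : Q0) (X : rep K Q n) :
  hom_sub_zero X (fun _ => setT) (simple_rep K Q a) -> row_full (phi a X).
Proof.
move=> hom.
have := @hom_sub_zero_surjective _ _ Q n a K X (fun _ => setT) (fun _ => 1%:M).
rewrite sub1mx => surj; rewrite -col_leq_rank.
have {surj} : row_full (block_sum Q a (fun i => 1%:M) *m phi a X).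
  by apply: surj => // i; rewrite ?mulmx1 ?row_image_mx1.
rewrite -col_leq_rank => /leq_trans; apply; exact: mxrankM_maxr.
Qed.

Section Main.
Variables (K : fieldType) (Q0 Q1 : finType) (Q : quiver Q0 Q1) (n : Q0 -> nat).
Variables (a : Q0) (X : rep K Q n) (nu : nat) (e : 'I_nu.+1 -> Q0 -> int).
Hypothesis sink_a : is_sink Q a.
Variables (rho : 'M[K]_(#|in_coord Q n a|, sink_dim a X a)).
Variable (sigma : 'M[K]_(n a, #|in_coord Q n a|)).
Hypothesis exact_X : split_exact (iota_mx a X) (phi a X) rho sigma.

Local Notation Y := (sink_reflection a X).
Local Notation er := (fun k => reflect_dim Q a (e k)).
Local Notation link R :=
  (linked (map_mx (in_alg R) (iota_mx a X)) (map_mx (in_alg R) (phi a X))).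

Lemma linked_sink_flag (R : comAlgType K) (U : flag nu R n) V :
  link R U V -> sink_flag (X := X) (a := a) U = V.
Proof.
move=> linkUV; apply: functional_extensionality_dep => k.
apply: functional_extensionality_dep => i; apply/seteqP; split=> v.
  have [ia|ia] := eq_or_neq i a.
    by subst i => /sink_flag_eq H; apply/(linked_eq linkUV).
  by move=> /(sink_flag_neq _ _ _ ia) H; apply/(linked_neq linkUV).
have [ia|ia] := eq_or_neq i a.
  by subst i => /(linked_eq linkUV) H; apply/sink_flag_eq.
by move=> /(linked_neq linkUV _ _ ia) H; apply/sink_flag_neq.
Qed.

Lemma link_map (R S : comAlgType K) (h : {lrmorphism R -> S}) (U : flag nu R n) V :
  link R U V -> link S (map_flag h U) (map_flag h V).
Proof.
(* Linearity of [h] over [K] enters here: matrices with entries in [K] are preserved. *)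
have hK p q (A : 'M[K]_(p, q)) : map_mx h (map_mx (in_alg R) A) = map_mx (in_alg S) A.
  by apply/matrixP => i j; rewrite !mxE /= linearZ rmorph1.
by move=> /(linked_map h); rewrite !hK.
Qed.

Lemma link_fibre (R : comAlgType K) (L : fieldType) (f : {rmorphism R -> L})
    (U : flag nu R n) V : link R U V ->
  linked (map_mx (f \o in_alg R) (iota_mx a X)) (map_mx (f \o in_alg R) (phi a X))
    (map_flag f U) (map_flag f V).
Proof. by move=> /(linked_map f); rewrite -!map_mx_comp. Qed.

Lemma link_pts_sink (R : comAlgType K) (U : flag nu R n) :
  pts (Fl_sink X e a) R U -> link R U (sink_flag (X := X) (a := a) U).
Proof.
move=> [flagU open].
have [V linkUV] := linked_of_sink exact_X flagU open.
by rewrite (linked_sink_flag linkUV).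
Qed.

Lemma link_pts_source (R : comAlgType K) (V : flag nu R (sink_dim a X)) :
  pts (Fl_source Y er a) R V -> exists U, link R U V.
Proof. by move=> [flagV open]; exact: (linked_of_source sink_a exact_X flagV open). Qed.

Lemma pts_source_of_link (R : comAlgType K) (U : flag nu R n) V :
  pts (Fl_sink X e a) R U -> link R U V -> pts (Fl_source Y er a) R V.
Proof.
move=> [flagU _] linkUV; split.
  exact: (linked_is_flag_source sink_a linkUV exact_X flagU).
move=> L f k; rewrite map_rep_comp.
exact: (linked_hom_quot_zero sink_a (link_fibre f linkUV)).
Qed.

Lemma pts_sink_of_link (R : comAlgType K) (U : flag nu R n) V :
  pts (Fl_source Y er a) R V -> link R U V -> pts (Fl_sink X e a) R U.
Proof.
move=> [flagV _] linkUV.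
have flagU := linked_is_flag_sink sink_a linkUV exact_X flagV.
split=> // L f k; rewrite map_rep_comp.
apply: (linked_hom_sub_zero (link_fibre f linkUV)).
by case: flagU => _ sub _ _; rewrite -map_rep_comp; apply: map_flag_subrep.
Qed.

End Main.

Theorem theorem6p15 (K : fieldType) (Q0 Q1 : finType) (Q : quiver Q0 Q1)
    (a : Q0) (nu : nat) (d : 'I_nu.+1 -> Q0 -> nat)
    (M : rep K Q (d ord_max)) :
  is_sink Q a ->
  is_filtration d ->
  hom_sub_zero M (fun _ => setT) (simple_rep K Q a) ->
  exists theta : (forall i, 'M[K]_(source_dim a (sink_reflection a M) i,
                                   d ord_max i)),
    is_identification a (source_reflection a (sink_reflection a M)) M theta /\
    is_isomorphism_with_inverse
      (X := Fl_sink M (fun k i => (d k i)%:Z) a)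
      (Y := Fl_source (sink_reflection a M)
              (fun k => reflect_dim Q a (fun i => (d k i)%:Z)) a)
      (fun R U => sink_flag (X := M) (a := a) U)
      (fun R V => transport_flag (fun i => map_mx (in_alg R) (theta i))
         (source_flag (Y := sink_reflection a M) (a := a) V)).
Proof.
move=> sink_a _ /hom_sub_zero_row_full/split_exact_iota[rho [sigma exact_M]].
have [theta [zeta [tz zt arrow]]] := identification_at_sink sink_a exact_M.
exists (glue_at theta); split; first exact: glue_at_identification tz zt arrow.
(* For linked flags the backward map returns [U], and [linked_sink_flag] says that the forward map
   returns [V]; each remaining goal then needs only a link, possibly after base change. *)
have inverse R U V := @transport_source_flag _ _ _ _ _ _ _ sink_a _ _ tz zt arrow nu R U V.
split.
- split=> [R U UX|R S h U UX].
    exact: (pts_source_of_link sink_a exact_M UX (link_pts_sink exact_M UX)).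
  have linkUV := link_pts_sink exact_M UX.
  exact: (linked_sink_flag (link_map h linkUV)).
- split=> [R V VY|R S h V VY];
    have [U linkUV] := link_pts_source sink_a exact_M VY; rewrite (inverse _ _ _ linkUV).
    exact: (pts_sink_of_link sink_a exact_M VY linkUV).
  exact: (inverse _ _ _ (link_map h linkUV)).
- by move=> R U UX; exact: (inverse _ _ _ (link_pts_sink exact_M UX)).
- move=> R V VY; have [U linkUV] := link_pts_source sink_a exact_M VY.
  by rewrite (inverse _ _ _ linkUV) (linked_sink_flag linkUV).
Qed.
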